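(* Let $n\ge1$. Up to specialization of the parameters, the generic Hecke algebras of the crystallographic complex reflection groups $[G(2,1,n)]_1^\alpha$, $[G(3,1,n)]_1$, $[G(4,1,n)]_1$ and $[G(6,1,n)]$ are isomorphic to the rank $n$ generalized double affine Hecke algebras (GDAHAs) attached respectively to the affine Dynkin diagrams $\mathcal D=D_4^{(1)},E_6^{(1)},E_7^{(1)},E_8^{(1)}$. Here ''up to specialization'' means: there is a ring homomorphism from the parameter ring of the generic Hecke algebra to the parameter ring $\mathbb C[u_{kj}^{\pm1},t^{\pm1}]$ of the GDAHA, sending the two parameters attached to the involutive generators $S_2,\dots,S_n$ to $t$ and $-t^{-1}$, and sending the remaining parameters bijectively to the $u_{kj}$ or their inverses, such that the base change of the generic Hecke algebra along it is isomorphic to the GDAHA as an algebra.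
   Context: **Groups.** $[G(2,1,n)]_1^\alpha$, with $\alpha$ in the modular strip (the standard fundamental domain of $SL_2(\mathbb Z)$ in the upper half-plane), is $G(2,1,n)\ltimes(\mathbb Z+\alpha\mathbb Z)^n$ acting on $\mathbb C^n$ by $z\mapsto gz+t$. For $d=3,4,6$, the groups $[G(3,1,n)]_1$, $[G(4,1,n)]_1$, $[G(6,1,n)]$ are $G(d,1,n)\ltimes\mathbb Z[e^{2\pi i/d}]^n$, acting likewise; $G(d,1,n)$ is the group of $n\times n$ monomial matrices whose nonzero entries are $d$-th roots of unity. **Generic Hecke algebras.** Each group has a presentation by reflections consisting of braid-type relations, order relations for the generators, and one extra order relation $\sigma_0^{e_0}=1$, where $\sigma_0$ is a given word in the generators. The generic Hecke algebra is the algebra over the Laurent polynomial ring in commuting parameters $\mathbf s_{ij}$, with one set of parameters for each orbit of reflection hyperplanes, with generators $S_i$ satisfying the braid-type relations and $\prod_{j=1}^{e_i}(S_i-\mathbf s_{ij})=0$ for each order relation $\sigma_i^{e_i}=1$, $i\ge0$, where $S_0$ is the word $\sigma_0$ with each $\sigma_k$ replaced by $S_k$ (the $S_i$ are invertible). Explicitly: *$[G(2,1,n)]_1^\alpha$*: generators $S_1,\dots,S_{n+2}$. If $n=1$ there are no braid-type relations. If $n\ge2$ the braid-type relations are: $S_iS_j=S_jS_i$ for $1\le i,j\le n$, $|i-j|>1$, and for $i\in\{n+1,n+2\}$, $j\le n-1$; $S_iS_{i+1}S_i=S_{i+1}S_iS_{i+1}$ for $2\le i\le n-1$; $S_iS_jS_iS_j=S_jS_iS_jS_i$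 for $(i,j)=(1,2),(n+1,n),(n+2,n)$; $S_nS_{n+1}S_n^{-1}S_{n+2}=S_{n+2}S_nS_{n+1}S_n^{-1}$. Moreover $S_0=S_1\cdots S_{n+2}S_n\cdots S_2$ (for $n=1$, $S_0=S_1S_2S_3$). All orders $e_i$ ($0\le i\le n+2$) equal $2$. The parameters are $\mathbf s_{0j},\mathbf s_{1j},\mathbf s_{n+1,j},\mathbf s_{n+2,j}$ ($j=1,2$), all independent, and, if $n\ge2$, a further pair $\mathbf s_{ij}$ ($j=1,2$) shared by all $2\le i\le n$. *$[G(3,1,n)]_1$, $[G(4,1,n)]_1$, $[G(6,1,n)]$*: generators $S_1,\dots,S_{n+1}$. If $n=1$ there are no braid-type relations. If $n\ge2$ the braid-type relations are: $S_iS_j=S_jS_i$ for $|i-j|>1$; $S_iS_{i+1}S_i=S_{i+1}S_iS_{i+1}$ for $2\le i\le n-1$; $S_iS_{i+1}S_iS_{i+1}=S_{i+1}S_iS_{i+1}S_i$ for $i=1$ and $i=n$. Moreover $S_0=S_1\cdots S_nS_{n+1}S_n\cdots S_2$ (for $n=1$, $S_0=S_1S_2$). The orders are $e_i=2$ for $2\le i\le n$, and $(e_0,e_1,e_{n+1})=(3,3,3)$, $(4,4,2)$, $(6,3,2)$ respectively. The parameters are $\mathbf s_{ij}$ for $i\in\{0,1,n+1\}$, $1\le j\le e_i$, all independent, and, if $n\ge2$, a further pair shared by all $2\le i\le n$. **GDAHA.** For a star-shaped simply laced diagram $\mathcal D$ with $m$ legs of lengths $d_1,\dots,d_m$ (number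 of vertices of the leg, central vertex included), the GDAHA of rank $n$ is the algebra over $\mathbb C[u_{kj}^{\pm1},t^{\pm1}]$ ($1\le k\le m$, $1\le j\le d_k$) with generators $U_1,\dots,U_m,T_1,\dots,T_{n-1}$ and relations: $\prod_{j=1}^{d_k}(U_k-u_{kj})=0$; $(T_i-t)(T_i+t^{-1})=0$; $U_1\cdots U_mT_1\cdots T_{n-1}T_{n-1}\cdots T_1=1$; $T_iT_j=T_jT_i$ for $|i-j|>1$; $T_iT_{i+1}T_i=T_{i+1}T_iT_{i+1}$ for $i\le n-2$; $U_iT_j=T_jU_i$ for $j\ge2$; $U_iT_1U_iT_1=T_1U_iT_1U_i$; $U_iT_1^{-1}U_jT_1=T_1^{-1}U_jT_1U_i$ for $i<j$. The leg lengths (in some order) are $(2,2,2,2)$ for $D_4^{(1)}$, $(3,3,3)$ for $E_6^{(1)}$, $(4,4,2)$ for $E_7^{(1)}$, $(6,3,2)$ for $E_8^{(1)}$. *)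

(* Defs.v *)
From HB Require Import structures.
From mathcomp Require Import all_boot all_order all_algebra generic_quotient.
From mathcomp Require Import boolp reals complex.

Set Implicit Arguments.
Unset Strict Implicit.
Unset Printing Implicit Defensive.

Import Order.TTheory GRing.Theory Num.Theory.
Local Open Scope ring_scope.
Local Open Scope quotient_scope.

(* MathComp's [algType] requires [1 != 0].  Nothing in the definition of an
   algebra given by generators and relations guarantees this, so an algebra
   over a commutative ring [R] is here a possibly zero ring with a central
   ring morphism [algmap] from [R]. *)
HB.mixin Record isPzAlgebra (R : comPzRingType) A of GRing.PzRing A := {
  algmap : {rmorphism R -> A};
  algmap_central : forall (a : R) (x : A), algmap a * x = x * algmap a
}.

#[short(type="pzAlgType")]
HB.structure Definition PzAlgebra (R : comPzRingType) :=
  {A of GRing.PzRing A & isPzAlgebra R A}.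

(* [term R G] is the syntax of noncommutative polynomial expressions over [R]
   in the letters [Gen g] and their formal inverses [GenV g]. *)
Inductive term (R G : Type) : Type :=
| Cst of R
| Gen of G
| GenV of G
| Opp of term R G
| Add of term R G & term R G
| Mul of term R G & term R G.

Arguments Cst {R G} _.
Arguments Gen {R G} _.
Arguments GenV {R G} _.

Declare Scope term_scope.
Delimit Scope term_scope with T.
Bind Scope term_scope with term.
Notation "x + y" := (Add x y) : term_scope.
Notation "x - y" := (Add x (Opp y)) : term_scope.
Notation "x * y" := (Mul x y) : term_scope.

Definition tprod (R : pzRingType) (G I : Type) (r : seq I)
    (F : I -> term R G) : term R G :=
  \big[@Mul R G/Cst 1]_(i <- r) F i.

HB.instance Definition _ (R G : Type) := gen_eqMixin (term R G).
HB.instance Definition _ (R G : Type) := gen_choiceMixin (term R G).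

Section PresentedAlgebra.

Variables (R : comPzRingType) (G : Type).
Variable rel : term R G -> term R G -> Prop.

(* The least congruence that contains the axioms of associative unital
   [R]-algebras, the invertibility of the letters, and [rel]. *)
Inductive cong : term R G -> term R G -> Prop :=
| cong_refl x : cong x x
| cong_sym x y : cong x y -> cong y x
| cong_trans x y z : cong x y -> cong y z -> cong x z
| cong_opp x x' : cong x x' -> cong (Opp x) (Opp x')
| cong_add x x' y y' : cong x x' -> cong y y' -> cong (x + y) (x' + y')
| cong_mul x x' y y' : cong x x' -> cong y y' -> cong (x * y) (x' * y')
| cong_addA x y z : cong (x + (y + z)) (x + y + z)
| cong_addC x y : cong (x + y) (y + x)
| cong_add0 x : cong (Cst 0 + x) x
| cong_addN x : cong (Opp x + x) (Cst 0)
| cong_mulA x y z : cong (x * (y * z)) (x * y * z)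
| cong_mul1l x : cong (Cst 1 * x) x
| cong_mul1r x : cong (x * Cst 1) x
| cong_mulDl x y z : cong ((x + y) * z) (x * z + y * z)
| cong_mulDr x y z : cong (x * (y + z)) (x * y + x * z)
| cong_cstD a b : cong (Cst (a + b)%R) (Cst a + Cst b)
| cong_cstM a b : cong (Cst (a * b)%R) (Cst a * Cst b)
| cong_cstC a x : cong (Cst a * x) (x * Cst a)
| cong_genV g : cong (Gen g * GenV g) (Cst 1)
| cong_Vgen g : cong (GenV g * Gen g) (Cst 1)
| cong_rel x y : rel x y -> cong x y.

Definition congb (x y : term R G) : bool := `[< cong x y >].

Lemma congb_refl : reflexive congb.
Proof. by move=> x; apply/asboolP; exact: cong_refl. Qed.

Lemma congb_sym : symmetric congb.
Proof. by move=> x y; apply/asboolP/asboolP; exact: cong_sym. Qed.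

Lemma congb_trans : transitive congb.
Proof.
by move=> y x z /asboolP xy /asboolP yz; apply/asboolP; exact: cong_trans yz.
Qed.

Canonical cong_equiv := EquivRel congb congb_refl congb_sym congb_trans.

Definition palg : Type := {eq_quot cong_equiv}.
HB.instance Definition _ := Choice.on palg.
HB.instance Definition _ := EqQuotient.on palg.

Definition pcls (x : term R G) : palg := \pi_palg x.

Lemma pclsP x y : pcls x = pcls y <-> cong x y.
Proof. by split=> [/eqmodP/asboolP|xy] //; apply/eqmodP/asboolP. Qed.

Lemma repr_cong x : cong (repr (pcls x)) x.
Proof. by apply/pclsP; rewrite /pcls reprK. Qed.

Lemma pcls_surj (u : palg) : u = pcls (repr u).
Proof. by rewrite /pcls reprK. Qed.

Definition padd (u v : palg) : palg := pcls (repr u + repr v)%T.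
Definition popp (u : palg) : palg := pcls (Opp (repr u)).
Definition pmul (u v : palg) : palg := pcls (repr u * repr v)%T.

Lemma paddE x y : padd (pcls x) (pcls y) = pcls (x + y)%T.
Proof. by apply/pclsP/cong_add; exact: repr_cong. Qed.

Lemma poppE x : popp (pcls x) = pcls (Opp x).
Proof. by apply/pclsP/cong_opp; exact: repr_cong. Qed.

Lemma pmulE x y : pmul (pcls x) (pcls y) = pcls (x * y)%T.
Proof. by apply/pclsP/cong_mul; exact: repr_cong. Qed.

Lemma paddA : associative padd.
Proof.
move=> u v w; rewrite (pcls_surj u) (pcls_surj v) (pcls_surj w) !paddE.
by apply/pclsP; exact: cong_addA.
Qed.

Lemma paddC : commutative padd.
Proof.
move=> u v; rewrite (pcls_surj u) (pcls_surj v) !paddE.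
by apply/pclsP; exact: cong_addC.
Qed.

Lemma padd0 : left_id (pcls (Cst 0)) padd.
Proof. by move=> u; rewrite (pcls_surj u) paddE; apply/pclsP/cong_add0. Qed.

Lemma paddN : left_inverse (pcls (Cst 0)) popp padd.
Proof.
by move=> u; rewrite (pcls_surj u) poppE paddE; apply/pclsP/cong_addN.
Qed.

HB.instance Definition _ := GRing.isZmodule.Build palg paddA paddC padd0 paddN.

Lemma pmulA : associative pmul.
Proof.
move=> u v w; rewrite (pcls_surj u) (pcls_surj v) (pcls_surj w) !pmulE.
by apply/pclsP; exact: cong_mulA.
Qed.

Lemma pmul1l : left_id (pcls (Cst 1)) pmul.
Proof. by move=> u; rewrite (pcls_surj u) pmulE; apply/pclsP/cong_mul1l. Qed.

Lemma pmul1r : right_id (pcls (Cst 1)) pmul.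
Proof. by move=> u; rewrite (pcls_surj u) pmulE; apply/pclsP/cong_mul1r. Qed.

Lemma pmulDl : left_distributive pmul +%R.
Proof.
move=> u v w; rewrite (pcls_surj u) (pcls_surj v) (pcls_surj w).
by rewrite /+%R /= paddE !pmulE paddE; apply/pclsP/cong_mulDl.
Qed.

Lemma pmulDr : right_distributive pmul +%R.
Proof.
move=> u v w; rewrite (pcls_surj u) (pcls_surj v) (pcls_surj w).
by rewrite /+%R /= paddE !pmulE paddE; apply/pclsP/cong_mulDr.
Qed.

HB.instance Definition _ :=
  GRing.Zmodule_isPzRing.Build palg pmulA pmul1l pmul1r pmulDl pmulDr.

Lemma pclsD x y : pcls (x + y)%T = pcls x + pcls y.
Proof. by rewrite -paddE. Qed.

Lemma pclsM x y : pcls (x * y)%T = pcls x * pcls y.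
Proof. by rewrite -pmulE. Qed.

Lemma pclsN x : pcls (Opp x) = - pcls x.
Proof. by rewrite -poppE. Qed.

Definition pcst (a : R) : palg := pcls (Cst a).

Lemma pcst_zmod : zmod_morphism pcst.
Proof.
have pcstD a b : pcst (a + b) = pcst a + pcst b.
  by rewrite -pclsD; apply/pclsP/cong_cstD.
by move=> a b; rewrite -[in RHS](subrK b a) [in RHS]pcstD addrK.
Qed.

Lemma pcst_monoid : monoid_morphism pcst.
Proof. by split=> // a b; rewrite -pclsM; apply/pclsP/cong_cstM. Qed.

HB.instance Definition _ := GRing.isZmodMorphism.Build R palg pcst pcst_zmod.
HB.instance Definition _ :=
  GRing.isMonoidMorphism.Build R palg pcst pcst_monoid.

Lemma pcst_central a (u : palg) : pcst a * u = u * pcst a.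
Proof. by rewrite (pcls_surj u) -!pclsM; apply/pclsP/cong_cstC. Qed.

HB.instance Definition _ := isPzAlgebra.Build R palg pcst_central.

Definition pgen (g : G) : palg := pcls (Gen g).
Definition pgenV (g : G) : palg := pcls (GenV g).

Lemma pgenVr g : pgen g * pgenV g = 1.
Proof. by rewrite -pclsM; apply/pclsP/cong_genV. Qed.

Lemma pgenVl g : pgenV g * pgen g = 1.
Proof. by rewrite -pclsM; apply/pclsP/cong_Vgen. Qed.

End PresentedAlgebra.

(* The Laurent polynomial ring [k[X_i, X_i^-1 : i in I]]: commuting invertible
   letters and no further relation. *)
Inductive laurent_rel (k : comPzRingType) (I : Type) :
    term k I -> term k I -> Prop :=
| laurent_comm i j : laurent_rel (Gen i * Gen j) (Gen j * Gen i).

Section Laurent.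

Variables (k : comPzRingType) (I : Type).

Definition laurent : Type := palg (@laurent_rel k I).
HB.instance Definition _ := PzAlgebra.on laurent.

Definition lX (i : I) : laurent := pgen (@laurent_rel k I) i.
Definition lXV (i : I) : laurent := pgenV (@laurent_rel k I) i.

Lemma laurent_commV (u v v' : laurent) :
  v * v' = 1 -> v' * v = 1 -> GRing.comm u v -> GRing.comm u v'.
Proof.
move=> vv' v'v uv; rewrite /GRing.comm -[LHS]mul1r -v'v -mulrA (mulrA v).
by rewrite -uv -(mulrA u) vv' mulr1.
Qed.

Lemma laurent_gen_comm (u : laurent) i : GRing.comm u (lX i).
Proof.
rewrite (pcls_surj u); elim: (repr u) => [a|j|j|x xi|x xi y yi|x xi y yi].
- by rewrite /GRing.comm /lX /pgen -!pclsM; apply/pclsP/cong_cstC.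
- rewrite /GRing.comm /lX /pgen -!pclsM; apply/pclsP/cong_rel.
  exact: laurent_comm.
- apply: commr_sym; apply: (laurent_commV (pgenVr _ j) (pgenVl _ j)).
  rewrite /GRing.comm /lX /pgen -!pclsM; apply/pclsP/cong_rel.
  exact: laurent_comm.
- by rewrite pclsN; apply: commr_sym; apply: commrN; exact: commr_sym.
- by rewrite pclsD; apply: commr_sym; apply: commrD; exact: commr_sym.
- by rewrite pclsM; apply: commr_sym; apply: commrM; exact: commr_sym.
Qed.

Lemma laurent_mulC : commutative (@GRing.mul laurent).
Proof.
move=> u v; rewrite (pcls_surj v).
elim: (repr v) => [a|j|j|x ux|x ux y uy|x ux y uy].
- rewrite (pcls_surj u) -!pclsM; apply/pclsP/cong_sym; exact: cong_cstC.
- exact: laurent_gen_comm.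
- exact: (laurent_commV (pgenVr _ j) (pgenVl _ j) (laurent_gen_comm u j)).
- by rewrite pclsN; exact: commrN.
- by rewrite pclsD; exact: commrD.
- by rewrite pclsM; exact: commrM.
Qed.

HB.instance Definition _ :=
  GRing.PzRing_hasCommutativeMul.Build laurent laurent_mulC.

End Laurent.

Inductive tens (B H : Type) : Type :=
| Pure of B & H
| TZero
| TOpp of tens B H
| TAdd of tens B H & tens B H.

Arguments TZero {B H}.

HB.instance Definition _ (B H : Type) := gen_eqMixin (tens B H).
HB.instance Definition _ (B H : Type) := gen_choiceMixin (tens B H).

(* [base_change phi H] is the tensor product of [B] and [H] over [A], where
   [B] is an [A]-module through [phi], with its usual algebra structure:
   see [tpureM] and [tcst] below. *)
Section BaseChange.

Variables (A B : comPzRingType) (phi : {rmorphism A -> B}) (H : pzAlgType A).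

Inductive tcong : tens B H -> tens B H -> Prop :=
| tcong_refl x : tcong x x
| tcong_sym x y : tcong x y -> tcong y x
| tcong_trans x y z : tcong x y -> tcong y z -> tcong x z
| tcong_opp x x' : tcong x x' -> tcong (TOpp x) (TOpp x')
| tcong_add x x' y y' :
    tcong x x' -> tcong y y' -> tcong (TAdd x y) (TAdd x' y')
| tcong_addA x y z : tcong (TAdd x (TAdd y z)) (TAdd (TAdd x y) z)
| tcong_addC x y : tcong (TAdd x y) (TAdd y x)
| tcong_add0 x : tcong (TAdd TZero x) x
| tcong_addN x : tcong (TAdd (TOpp x) x) TZero
| tcong_pureDl b b' h :
    tcong (Pure (b + b') h) (TAdd (Pure b h) (Pure b' h))
| tcong_pureDr b h h' :
    tcong (Pure b (h + h')) (TAdd (Pure b h) (Pure b h'))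
| tcong_pureZ b a h : tcong (Pure b (algmap a * h)) (Pure (b * phi a) h).

Definition tcongb (x y : tens B H) : bool := `[< tcong x y >].

Lemma tcongb_refl : reflexive tcongb.
Proof. by move=> x; apply/asboolP; exact: tcong_refl. Qed.

Lemma tcongb_sym : symmetric tcongb.
Proof. by move=> x y; apply/asboolP/asboolP; exact: tcong_sym. Qed.

Lemma tcongb_trans : transitive tcongb.
Proof.
by move=> y x z /asboolP xy /asboolP yz; apply/asboolP; exact: tcong_trans yz.
Qed.

Canonical tcong_equiv := EquivRel tcongb tcongb_refl tcongb_sym tcongb_trans.

Definition base_change : Type := {eq_quot tcong_equiv}.
HB.instance Definition _ := Choice.on base_change.
HB.instance Definition _ := EqQuotient.on base_change.

Definition tcls (x : tens B H) : base_change := \pi_base_change x.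

Lemma tclsP x y : tcls x = tcls y <-> tcong x y.
Proof. by split=> [/eqmodP/asboolP|xy] //; apply/eqmodP/asboolP. Qed.

Lemma trepr_cong x : tcong (repr (tcls x)) x.
Proof. by apply/tclsP; rewrite /tcls reprK. Qed.

Lemma tcls_surj (u : base_change) : u = tcls (repr u).
Proof. by rewrite /tcls reprK. Qed.

Definition tadd (u v : base_change) : base_change :=
  tcls (TAdd (repr u) (repr v)).
Definition topp (u : base_change) : base_change := tcls (TOpp (repr u)).

Lemma taddE x y : tadd (tcls x) (tcls y) = tcls (TAdd x y).
Proof. by apply/tclsP/tcong_add; exact: trepr_cong. Qed.

Lemma toppE x : topp (tcls x) = tcls (TOpp x).
Proof. by apply/tclsP/tcong_opp; exact: trepr_cong. Qed.

Lemma taddA : associative tadd.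
Proof.
move=> u v w; rewrite (tcls_surj u) (tcls_surj v) (tcls_surj w) !taddE.
by apply/tclsP; exact: tcong_addA.
Qed.

Lemma taddC : commutative tadd.
Proof.
move=> u v; rewrite (tcls_surj u) (tcls_surj v) !taddE.
by apply/tclsP; exact: tcong_addC.
Qed.

Lemma tadd0 : left_id (tcls TZero) tadd.
Proof. by move=> u; rewrite (tcls_surj u) taddE; apply/tclsP/tcong_add0. Qed.

Lemma taddN : left_inverse (tcls TZero) topp tadd.
Proof.
by move=> u; rewrite (tcls_surj u) toppE taddE; apply/tclsP/tcong_addN.
Qed.

HB.instance Definition _ :=
  GRing.isZmodule.Build base_change taddA taddC tadd0 taddN.

Definition tpure (b : B) (h : H) : base_change := tcls (Pure b h).

Lemma tpureDl b b' h : tpure (b + b') h = tpure b h + tpure b' h.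
Proof. by rewrite /tpure /+%R /= taddE; apply/tclsP/tcong_pureDl. Qed.

Lemma tpureDr b h h' : tpure b (h + h') = tpure b h + tpure b h'.
Proof. by rewrite /tpure /+%R /= taddE; apply/tclsP/tcong_pureDr. Qed.

Lemma tpure_balanced b a h : tpure b (algmap a * h) = tpure (b * phi a) h.
Proof. by apply/tclsP/tcong_pureZ. Qed.

Lemma base_change_ind (P : base_change -> Prop) :
    (forall b h, P (tpure b h)) -> P 0 ->
    (forall u, P u -> P (- u)) -> (forall u v, P u -> P v -> P (u + v)) ->
  forall u, P u.
Proof.
move=> Ppure P0 PN PD u; rewrite (tcls_surj u).
elim: (repr u) => [b h||x Px|x Px y Py].
- exact: Ppure.
- exact: P0.
- by move: (PN _ Px); rewrite /-%R /= toppE.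
- by move: (PD _ _ Px Py); rewrite /+%R /= taddE.
Qed.

Section Lift.

Variables (V : zmodType) (f : B -> H -> V).

Fixpoint teval (x : tens B H) : V :=
  match x with
  | Pure b h => f b h
  | TZero => 0
  | TOpp x => - teval x
  | TAdd x y => teval x + teval y
  end.

Definition tlift (u : base_change) : V := teval (repr u).

Hypothesis fDl : forall b b' h, f (b + b') h = f b h + f b' h.
Hypothesis fDr : forall b h h', f b (h + h') = f b h + f b h'.
Hypothesis fZ : forall b a h, f b (algmap a * h) = f (b * phi a) h.

Lemma teval_cong x y : tcong x y -> teval x = teval y.
Proof.
elim=> //= {x y}.
- by move=> x y z _ -> _ ->.
- by move=> x x' _ ->.
- by move=> x x' y y' _ -> _ ->.
- by move=> x y z; rewrite addrA.
- by move=> x y; rewrite addrC.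
- by move=> x; rewrite add0r.
- by move=> x; rewrite addNr.
Qed.

Lemma tliftE x : tlift (tcls x) = teval x.
Proof. exact/teval_cong/trepr_cong. Qed.

Lemma tlift_pure b h : tlift (tpure b h) = f b h.
Proof. exact: tliftE. Qed.

Lemma tlift0 : tlift 0 = 0.
Proof. exact: tliftE. Qed.

Lemma tliftN u : tlift (- u) = - tlift u.
Proof. by rewrite (tcls_surj u) /-%R /= toppE !tliftE. Qed.

Lemma tliftD u v : tlift (u + v) = tlift u + tlift v.
Proof.
by rewrite (tcls_surj u) (tcls_surj v) {1}/+%R /= taddE !tliftE.
Qed.

End Lift.

Definition tmull (b : B) (h : H) (v : base_change) : base_change :=
  tlift (fun b' h' => tpure (b * b') (h * h')) v.

Definition tmul (u v : base_change) : base_change :=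
  tlift (fun b h => tmull b h v) u.

Section TMull.

Variables (b : B) (h : H).
Let f b' h' := tpure (b * b') (h * h').

Let fDl b1 b2 h' : f (b1 + b2) h' = f b1 h' + f b2 h'.
Proof. by rewrite /f mulrDr tpureDl. Qed.

Let fDr b' h1 h2 : f b' (h1 + h2) = f b' h1 + f b' h2.
Proof. by rewrite /f mulrDr tpureDr. Qed.

Let fZ b' a h' : f b' (algmap a * h') = f (b' * phi a) h'.
Proof.
by rewrite /f (mulrA h) -algmap_central -(mulrA _ h) tpure_balanced mulrA.
Qed.

Lemma tmull_pure b' h' : tmull b h (tpure b' h') = tpure (b * b') (h * h').
Proof. exact: (tlift_pure fDl fDr fZ). Qed.

Lemma tmull0 : tmull b h 0 = 0.
Proof. exact: (tlift0 fDl fDr fZ). Qed.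

Lemma tmullN v : tmull b h (- v) = - tmull b h v.
Proof. exact: (tliftN fDl fDr fZ). Qed.

Lemma tmullD v w : tmull b h (v + w) = tmull b h v + tmull b h w.
Proof. exact: (tliftD fDl fDr fZ). Qed.

End TMull.

Section TMul.

Variable v : base_change.
Let f b h := tmull b h v.

Let fDl b1 b2 h : f (b1 + b2) h = f b1 h + f b2 h.
Proof.
rewrite /f; elim/base_change_ind: v => [b' h'||u e|u w eu ew].
- by rewrite !tmull_pure mulrDl tpureDl.
- by rewrite !tmull0 addr0.
- by rewrite !tmullN e opprD.
- by rewrite !tmullD eu ew addrACA.
Qed.

Let fDr b h1 h2 : f b (h1 + h2) = f b h1 + f b h2.
Proof.
rewrite /f; elim/base_change_ind: v => [b' h'||u e|u w eu ew].
- by rewrite !tmull_pure mulrDl tpureDr.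
- by rewrite !tmull0 addr0.
- by rewrite !tmullN e opprD.
- by rewrite !tmullD eu ew addrACA.
Qed.

Let fZ b a h : f b (algmap a * h) = f (b * phi a) h.
Proof.
rewrite /f; elim/base_change_ind: v => [b' h'||u e|u w eu ew].
- by rewrite !tmull_pure -(mulrA _ h) tpure_balanced mulrAC.
- by rewrite !tmull0.
- by rewrite !tmullN e.
- by rewrite !tmullD eu ew.
Qed.

Lemma tmul_pureE b h : tmul (tpure b h) v = tmull b h v.
Proof. exact: (tlift_pure fDl fDr fZ). Qed.

Lemma tmul0l : tmul 0 v = 0.
Proof. exact: (tlift0 fDl fDr fZ). Qed.

Lemma tmulNl u : tmul (- u) v = - tmul u v.
Proof. exact: (tliftN fDl fDr fZ). Qed.

Lemma tmulDl u w : tmul (u + w) v = tmul u v + tmul w v.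
Proof. exact: (tliftD fDl fDr fZ). Qed.

End TMul.

Lemma tmul0r u : tmul u 0 = 0.
Proof.
elim/base_change_ind: u => [b h||u e|u w eu ew].
- by rewrite tmul_pureE tmull0.
- by rewrite tmul0l.
- by rewrite tmulNl e oppr0.
- by rewrite tmulDl eu ew addr0.
Qed.

Lemma tmulNr u v : tmul u (- v) = - tmul u v.
Proof.
elim/base_change_ind: u => [b h||u e|u w eu ew].
- by rewrite !tmul_pureE tmullN.
- by rewrite !tmul0l oppr0.
- by rewrite !tmulNl e.
- by rewrite !tmulDl eu ew opprD.
Qed.

Lemma tmulDr u v w : tmul u (v + w) = tmul u v + tmul u w.
Proof.
elim/base_change_ind: u => [b h||u e|u u' eu eu'].
- by rewrite !tmul_pureE tmullD.
- by rewrite !tmul0l addr0.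
- by rewrite !tmulNl e opprD.
- by rewrite !tmulDl eu eu' addrACA.
Qed.

Lemma tmul_pure b h b' h' :
  tmul (tpure b h) (tpure b' h') = tpure (b * b') (h * h').
Proof. by rewrite tmul_pureE tmull_pure. Qed.

Lemma tmulA : associative tmul.
Proof.
move=> u v w; elim/base_change_ind: u => [b h||u e|u u' eu eu'].
- elim/base_change_ind: v => [b' h'||v e|v v' ev ev'].
  + elim/base_change_ind: w => [b2 h2||w e|w w' ew ew'].
    * by rewrite !tmul_pure !mulrA.
    * by rewrite !tmul0r.
    * by rewrite !tmulNr e.
    * by rewrite !tmulDr ew ew'.
  + by rewrite !(tmul0l, tmul0r).
  + by rewrite !(tmulNl, tmulNr) e.
  + by rewrite !(tmulDl, tmulDr) ev ev'.
- by rewrite !tmul0l.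
- by rewrite !tmulNl e.
- by rewrite !tmulDl eu eu'.
Qed.

Lemma tmul1l : left_id (tpure 1 1) tmul.
Proof.
elim/base_change_ind => [b h||u e|u w eu ew].
- by rewrite tmul_pure !mul1r.
- by rewrite tmul0r.
- by rewrite tmulNr e.
- by rewrite tmulDr eu ew.
Qed.

Lemma tmul1r : right_id (tpure 1 1) tmul.
Proof.
elim/base_change_ind => [b h||u e|u w eu ew].
- by rewrite tmul_pure !mulr1.
- by rewrite tmul0l.
- by rewrite tmulNl e.
- by rewrite tmulDl eu ew.
Qed.

Lemma tmul_distl : left_distributive tmul +%R.
Proof. by move=> u v w; exact: tmulDl. Qed.

Lemma tmul_distr : right_distributive tmul +%R.
Proof. by move=> u v w; exact: tmulDr. Qed.

HB.instance Definition _ := GRing.Zmodule_isPzRing.Build base_change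
  tmulA tmul1l tmul1r tmul_distl tmul_distr.

Lemma tpureM b h b' h' : tpure b h * tpure b' h' = tpure (b * b') (h * h').
Proof. exact: tmul_pure. Qed.

Definition tcst (b : B) : base_change := tpure b 1.

Lemma tcst_zmod : zmod_morphism tcst.
Proof.
by move=> a b; rewrite -[in RHS](subrK b a) [in RHS]/tcst tpureDl addrK.
Qed.

Lemma tcst_monoid : monoid_morphism tcst.
Proof. by split=> // a b; rewrite /tcst tpureM mulr1. Qed.

HB.instance Definition _ :=
  GRing.isZmodMorphism.Build B base_change tcst tcst_zmod.
HB.instance Definition _ :=
  GRing.isMonoidMorphism.Build B base_change tcst tcst_monoid.

Lemma tcst_central b (u : base_change) : tcst b * u = u * tcst b.
Proof.
elim/base_change_ind: u => [c h||u e|u w eu ew].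
- by rewrite /tcst !tpureM mulrC mul1r mulr1.
- by rewrite mulr0 mul0r.
- by rewrite mulrN mulNr e.
- by rewrite mulrDr mulrDl eu ew.
Qed.

HB.instance Definition _ := isPzAlgebra.Build B base_change tcst_central.

End BaseChange.

(* The closed standard fundamental domain; every convention about which part
   of its boundary belongs to the modular strip is covered. *)
Definition modular_strip (R : realType) (alpha : R[i]) : bool :=
  [&& 0 < complex.Im alpha, `|complex.Re alpha| <= 1 / 2 & 1 <= `|alpha|].

(* [G2 alpha _], [G3], [G4], [G6] stand for the four families
   [G(2,1,n)]_1^alpha, [G(3,1,n)]_1, [G(4,1,n)]_1, [G(6,1,n)].  The
   presentation of the first family does not involve [alpha]. *)
Inductive cryst_family (R : realType) : Type :=
| G2 (alpha : R[i]) of modular_strip alpha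
| G3
| G4
| G6.

Arguments G3 {R}.
Arguments G4 {R}.
Arguments G6 {R}.

Definition isG2 (R : realType) (W : cryst_family R) : bool :=
  if W is G2 _ _ then true else false.

(* Labels of generators, parameters and legs are the 1-based naturals of the
   usual notation; subtypes of [nat] or [nat * nat] record the admissible
   labels.  The accessors [S_ i], [s_ i j], [U_ k], [T_ i], [u_ k j] are total,
   and their value at inadmissible labels is never used. *)
Section Hecke.

Variables (k : comPzRingType) (R : realType) (W : cryst_family R) (n : nat).

Definition ngens : nat := if isG2 W then n.+2 else n.+1.

Definition refl_order (i : nat) : nat :=
  if (2 <= i <= n)%N then 2%N else
  match W with
  | G2 _ _ => 2%N
  | G3 => 3%N
  | G4 => if i == n.+1 then 2%N else 4%N
  | G6 => if i == 0%N then 6%N else if i == n.+1 then 2%N else 3%N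
  end.

Definition special_param : Type :=
  {ij : nat * nat |
    [&& (ij.1 <= ngens)%N, ~~ (2 <= ij.1 <= n)%N
      & (1 <= ij.2 <= refl_order ij.1)%N]}.

Definition shared_param : Type := {j : nat | (1 < n)%N && (1 <= j <= 2)%N}.

Definition hecke_param : Type := (special_param + shared_param)%type.

Definition hecke_ring : comPzRingType := laurent k hecke_param.

Definition s_ (i j : nat) : hecke_ring :=
  if (2 <= i <= n)%N
  then oapp (fun x : shared_param => lX k (inr x : hecke_param)) 0 (insub j)
  else oapp (fun x : special_param => lX k (inl x : hecke_param)) 0
            (insub (i, j)).

Definition hecke_gen : Type := {i : nat | (1 <= i <= ngens)%N}.

Local Notation hterm := (term hecke_ring hecke_gen).

Definition sigma0 : seq nat := iota 1 ngens ++ rev (iota 2 n.-1).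

Definition S_ (i : nat) : hterm :=
  oapp (fun g : hecke_gen => Gen g) (Cst 1) (insub i).
Definition SV_ (i : nat) : hterm :=
  oapp (fun g : hecke_gen => GenV g) (Cst 1) (insub i).

Definition S0 : hterm := tprod sigma0 S_.

Definition refl_elt (i : nat) : hterm := if i == 0%N then S0 else S_ i.

Definition hecke_commuting (i j : nat) : bool :=
  if isG2 W then
    [&& 1 <= i <= n, 1 <= j <= n & (i.+1 < j) || (j.+1 < i)]%N
    || ((i == n.+1) || (i == n.+2)) && (1 <= j <= n.-1)%N
  else [&& 1 <= i <= n.+1, 1 <= j <= n.+1 & (i.+1 < j) || (j.+1 < i)]%N.

Definition hecke_braid4 : seq (nat * nat) :=
  (if isG2 W then [:: (1, 2); (n.+1, n); (n.+2, n)]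
   else [:: (1, 2); (n, n.+1)])%N.

Inductive hecke_rel : hterm -> hterm -> Prop :=
| hecke_comm (i j : nat) of (1 < n)%N & hecke_commuting i j :
    hecke_rel (S_ i * S_ j) (S_ j * S_ i)
| hecke_braid3_rel i of (1 < n)%N & (2 <= i <= n.-1)%N :
    hecke_rel (S_ i * S_ i.+1 * S_ i) (S_ i.+1 * S_ i * S_ i.+1)
| hecke_braid4_rel (i j : nat) of (1 < n)%N & (i, j) \in hecke_braid4 :
    hecke_rel (S_ i * S_ j * S_ i * S_ j) (S_ j * S_ i * S_ j * S_ i)
| hecke_twist of (1 < n)%N & isG2 W :
    hecke_rel (S_ n * S_ n.+1 * SV_ n * S_ n.+2)
              (S_ n.+2 * S_ n * S_ n.+1 * SV_ n)
| hecke_order i of (i <= ngens)%N :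
    hecke_rel
      (tprod (iota 1 (refl_order i)) (fun j => refl_elt i - Cst (s_ i j))%T)
      (Cst 0).

Definition hecke : pzAlgType hecke_ring := palg hecke_rel.

End Hecke.

Section GDAHA.

Variables (K : comPzRingType) (d : seq nat) (n : nat).

(* [d] lists the leg lengths of a star-shaped diagram, in the chosen order. *)
Definition leg (k : nat) : nat := nth 0%N d k.-1.

Definition leg_param : Type :=
  {kj : nat * nat | (1 <= kj.1 <= size d)%N && (1 <= kj.2 <= leg kj.1)%N}.

Definition gdaha_param : Type := (leg_param + unit)%type.

Definition gdaha_ring : comPzRingType := laurent K gdaha_param.

Definition u_ (k j : nat) : gdaha_ring :=
  oapp (fun x : leg_param => lX K (inl x : gdaha_param)) 0 (insub (k, j)).
Definition t_ : gdaha_ring := lX K (inr tt : gdaha_param).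
Definition tV_ : gdaha_ring := lXV K (inr tt : gdaha_param).

Definition gdaha_gen : Type :=
  ({k : nat | (1 <= k <= size d)%N} + {i : nat | (1 <= i < n)%N})%type.

Local Notation gterm := (term gdaha_ring gdaha_gen).

Definition U_ (k : nat) : gterm :=
  oapp (fun x : {k : nat | (1 <= k <= size d)%N} => Gen (inl x : gdaha_gen))
       (Cst 1) (insub k).
Definition T_ (i : nat) : gterm :=
  oapp (fun x : {i : nat | (1 <= i < n)%N} => Gen (inr x : gdaha_gen))
       (Cst 1) (insub i).
Definition TV_ (i : nat) : gterm :=
  oapp (fun x : {i : nat | (1 <= i < n)%N} => GenV (inr x : gdaha_gen))
       (Cst 1) (insub i).

Inductive gdaha_rel : gterm -> gterm -> Prop :=
| gdaha_leg k of (1 <= k <= size d)%N :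
    gdaha_rel (tprod (iota 1 (leg k)) (fun j => U_ k - Cst (u_ k j))%T)
              (Cst 0)
| gdaha_quad i of (1 <= i < n)%N :
    gdaha_rel ((T_ i - Cst t_) * (T_ i + Cst tV_)) (Cst 0)
| gdaha_prod :
    gdaha_rel (tprod (iota 1 (size d)) U_
               * tprod (iota 1 n.-1 ++ rev (iota 1 n.-1)) T_) (Cst 1)
| gdaha_commT i j of (1 <= i < n)%N & (1 <= j < n)%N
                   & ((i.+1 < j) || (j.+1 < i))%N :
    gdaha_rel (T_ i * T_ j) (T_ j * T_ i)
| gdaha_braid3 i of (1 <= i)%N & (i.+1 < n)%N :
    gdaha_rel (T_ i * T_ i.+1 * T_ i) (T_ i.+1 * T_ i * T_ i.+1)
| gdaha_commUT k j of (1 <= k <= size d)%N & (2 <= j < n)%N :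
    gdaha_rel (U_ k * T_ j) (T_ j * U_ k)
| gdaha_braid4 k of (1 <= k <= size d)%N & (1 < n)%N :
    gdaha_rel (U_ k * T_ 1 * U_ k * T_ 1) (T_ 1 * U_ k * T_ 1 * U_ k)
| gdaha_twist k l of (1 <= k)%N & (k < l)%N & (l <= size d)%N & (1 < n)%N :
    gdaha_rel (U_ k * TV_ 1 * U_ l * T_ 1) (TV_ 1 * U_ l * T_ 1 * U_ k).

Definition gdaha : pzAlgType gdaha_ring := palg gdaha_rel.

End GDAHA.

Inductive affine_diagram : Type := D4aff | E6aff | E7aff | E8aff.

Definition leg_lengths (D : affine_diagram) : seq nat :=
  match D with
  | D4aff => [:: 2; 2; 2; 2]%N
  | E6aff => [:: 3; 3; 3]%N
  | E7aff => [:: 4; 4; 2]%N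
  | E8aff => [:: 6; 3; 2]%N
  end.

Definition diagram_of (R : realType) (W : cryst_family R) : affine_diagram :=
  match W with
  | G2 _ _ => D4aff
  | G3 => E6aff
  | G4 => E7aff
  | G6 => E8aff
  end.

Definition alg_isomorphic (B : comPzRingType) (X Y : pzAlgType B) : Prop :=
  exists f : {rmorphism X -> Y},
    bijective f /\ forall b : B, f (algmap b) = algmap b.

(* Main.v *)
From HB Require Import structures.
From mathcomp Require Import all_boot all_order all_algebra generic_quotient.
From mathcomp Require Import zify.
From mathcomp Require Import boolp reals complex.
Require Import Defs.

(** Both algebras are generated by invertible elements, and except for the
    equations that make the generators algebraic, all relations are relations
    between words in a group.  So the theorem splits into group theory, done
    in an arbitrary group, and a formal argument on universal properties.

    Group theory.  Let [T = t_1, ..., t_m] be the generators [S_2, ..., S_n]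
    of the Hecke algebra, let [c] be their product and let [P] be the product
    of [t_1, ..., t_m, t_m, ..., t_1].  The GDAHA has the same [T], and its other
    generators are loops of the first strand around the punctures of a sphere.
    The generator [S_1] is such a loop, while [S_(n+1)] (and [S_(n+2)]) are
    loops of the last strand.  Conjugation by [c^-1] carries the last strand to
    the first, and turns exactly the braid relations of the last strand into
    those of the first ([slide_system]).  Given all loops but one, with product
    [A], the relation that [A], the last loop and [P] have product 1 only
    defines the last loop as [(P * A)^-1], whose braid relations follow from
    those of the other loops ([closing_system]).  This last loop is conjugate
    to the inverse of the Hecke word [S_0] ([closing_slide]), which is why the
    parameters of [S_0] are sent to inverses.

    Order of the legs.  This gives the GDAHA for one order of the legs, where
    the leg of [S_0] comes last.  The Hurwitz move replaces
    consecutive loops [x, y] by [y, y^-1 * x * y]: it preserves the product, the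
    braid relations ([leg_system_hurwitz]) and, up to the exchange of two
    neighbours, the equation of each loop, because it only conjugates.  Hence
    the GDAHA does not depend on the order of the legs
    ([gdaha_relations_perm]).

    Universal properties.  An algebra with a list of units is [universal] for a
    system of relations when its morphisms to any algebra [Y] are the lists of
    units of [Y] that obey the system.  The base change of the Hecke algebra
    and the GDAHA are universal for their relations ([hecke_universal],
    [gdaha_universal]).  Mutually inverse natural rewritings of lists
    carry universal lists to universal lists ([universal_change]), and
    two algebras that are universal for one system are isomorphic
    ([universal_iso]). *)

Set Implicit Arguments.
Unset Strict Implicit.
Unset Printing Implicit Defensive.

(** * Loops and half-twists in a group *)

Section BraidSystems.
Local Open Scope group_scope.

Variable G : groupType.
Implicit Types (x y z t g : G) (T U V : seq G).

Definition commb x y := x * y == y * x.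
Definition braid3 s t := s * t * s == t * s * t.
Definition braid4 x t := commb x (t * x * t).

Lemma commbP x y : reflect (commute x y) (commb x y).
Proof. exact: eqP. Qed.

Lemma commbC x y : commb x y = commb y x.
Proof. exact: eq_sym. Qed.

Lemma commb_refl x : commb x x.
Proof. exact: eqxx. Qed.

Lemma commbJ x y g : commb (x ^ g) (y ^ g) = commb x y.
Proof. by rewrite /commb -!conjMg (inj_eq (@conjg_inj _ g)). Qed.

Lemma commb_conjg x y : commb x y -> x ^ y = x.
Proof. by move/commbP => xy; rewrite conjgE xy mulKg. Qed.

Lemma commb_conjgV x y : commb x y -> x ^ y^-1 = x.
Proof. by move=> xy; rewrite -[in LHS](commb_conjg xy) conjgK. Qed.

Lemma braid4J x t g : braid4 (x ^ g) (t ^ g) = braid4 x t.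
Proof. by rewrite /braid4 -!conjMg commbJ. Qed.

Lemma commute_conj x y z : commute x y -> commute x z -> commute x (y ^ z).
Proof.
by move=> xy xz; apply: commuteM; [exact: commuteV | exact: commuteM].
Qed.

Lemma commute_prodg x V : {in V, forall y, commute x y} ->
  commute x (\prod_(y <- V) y).
Proof.
by move=> xV; rewrite big_seq; apply: big_rec => [|y z /xV];
  [exact: commute1 | exact: commuteM].
Qed.

Lemma braid3C s t : braid3 s t = braid3 t s.
Proof. exact: eq_sym. Qed.

(** The form in which the braid relation is used: it lets a conjugation by [s]
    be traded for one by [t]. *)
Lemma braid3_conj s t : braid3 s t -> t ^ s = s ^ t^-1.
Proof.
move=> /eqP sts; apply: (mulgI s); rewrite !conjgE invgK mulVKg.
by apply: (mulIg t); rewrite !mulgA mulgVK sts.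
Qed.

(** The relations of the half-twists of adjacent strands, for strands
    numbered along the list. *)
Fixpoint braid_chain T :=
  if T is t :: T' then
    (if T' is t' :: T'' then braid3 t t' && all (commb t) T'' else true)
      && braid_chain T'
  else true.

(** The relations between [T] and a loop [x] of the first strand.  A loop
    [y] of the last strand satisfies [near (rev T) y]. *)
Definition near T x :=
  if T is t :: T' then braid4 x t && all (commb x) T' else true.

(** The relation between two loops of the first strand, [x] around an
    earlier puncture than [y]: after a half-twist they belong to distinct
    strands.  It is void when there is only one strand. *)
Definition twist T x y := if T is t :: _ then commb x (y ^ t) else true.

(** The relation that [twist] becomes for two loops of the last strand. *)
Definition twist_last T x y :=
  if T is t :: T' then commb (x ^ (last t T')^-1) y else true.

(** The turn of the first strand around all the others. *)
Definition pure_turn T := (\prod_(t <- T) t) * \prod_(t <- rev T) t.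

Lemma near_rcons T t x :
  T != [::] -> near (rcons T t) x = commb x t && near T x.
Proof. by case: T => // s T _; rewrite /= all_rcons andbCA. Qed.

Lemma chain_tail t t' T : braid_chain (t :: t' :: T) ->
  commb (\prod_(s <- T) s) t.
Proof.
move=> /andP[/andP[_ /allP tT] _]; rewrite commbC.
by apply/commbP/commute_prodg => s /tT/commbP.
Qed.

Section Slide.

Variables (t t' : G) (T : seq G) (z : G).
Hypothesis chainT : braid_chain (t :: t' :: T).

Let tt' : braid3 t t'. Proof. by case/andP: chainT => /andP[]. Qed.

(** With [g := t'^-1 * t^-1], the braid relation says that [t ^ g = t']; both
    sides are thus conjugate by [g]. *)
Lemma slide_comm : commb ((z ^ t'^-1) ^ t^-1) t' = commb z t.
Proof.
rewrite -[RHS](commbJ _ _ t'^-1) -[RHS](commbJ _ _ t^-1).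
by rewrite -(braid3_conj tt') conjgK.
Qed.

(** Both pairs are conjugate to [(z, t')].  The right one is so by [t']; the
    left one is carried by [t] and [t'] to [(z, t' ^ t^-1)], which is conjugate
    by [t] to [(z, t')] because [t] fixes [z]. *)
Lemma slide_braid4 : commb z t ->
  braid4 ((z ^ t'^-1) ^ t^-1) t = braid4 (z ^ t'^-1) t'.
Proof.
move=> zt; have conjid g : g ^ g = g by exact/commb_conjg/commb_refl.
rewrite -[LHS](braid4J _ _ t) -[RHS](braid4J _ _ t') !conjgKV !conjid.
rewrite -[LHS](braid4J _ _ t') conjgKV (@braid3_conj t') 1?braid3C //.
by rewrite -{1}(commb_conjgV zt) braid4J.
Qed.

End Slide.

(** A loop is carried from the last strand to the first, one strand at a time.
    In the inductive step the product of all half-twists but the first two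
    commutes with the first one, so that [slide_comm] and [slide_braid4] apply
    to the loop [z] of the third strand. *)
Lemma near_slide T y : braid_chain T ->
  near T (y ^ (\prod_(t <- T) t)^-1) = near (rev T) y.
Proof.
elim: T => // t [|t' T] IH chT.
  by rewrite big_seq1 /= !andbT -[RHS](braid4J _ _ t^-1) [t ^ _]commb_conjgV
    ?commb_refl.
rewrite rev_cons near_rcons -?size_eq0 ?size_rev // -IH; last by case/andP: chT.
rewrite !(big_cons _ _ t) !(big_cons _ _ t') !invgM !conjgM.
set z := y ^ _; have -> : commb y t = commb z t.
  by rewrite -(commbJ y t (\prod_(s <- T) s)^-1) [t ^ _]commb_conjgV // commbC
     (chain_tail chT).
rewrite /= (slide_comm z chT).
case zt: (commb z t) => //=; last by rewrite andbF.
rewrite (slide_braid4 chT zt); congr andb; apply: eq_in_all => s sT.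
have ts : commb s t by case/andP: chT => /andP[_ /allP tT] _; rewrite commbC tT.
by rewrite -[s in LHS](commb_conjgV ts) commbJ.
Qed.

(** The product of all half-twists but the first commutes with [x], so that
    conjugating by it leaves only a commutation of [x] with [y]. *)
Lemma near_twist_slide T x y : braid_chain T -> T != [::] -> near T x ->
  twist T x (y ^ (\prod_(t <- T) t)^-1) = commb x y.
Proof.
case: T => // t T _ _ /andP[_ /allP xT].
rewrite /= big_cons invgM conjgM conjgKV.
rewrite -[RHS](commbJ _ _ (\prod_(s <- T) s)^-1).
rewrite [x ^ _]commb_conjgV //.
by apply/commbP/commute_prodg => s /xT/commbP.
Qed.

Lemma twist_slide T y1 y2 : braid_chain T ->
    near (rev T) y1 -> near (rev T) y2 ->
  let c := \prod_(t <- T) t in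
  twist T (y1 ^ c^-1) (y2 ^ c^-1) = twist_last T y1 y2.
Proof.
move=> chT y1T y2T /=; elim: T chT y1T y2T => // t [|t' T] IH chT.
  by rewrite big_seq1 /= conjgKV.
rewrite rev_cons !near_rcons -?size_eq0 ?size_rev //.
move=> /andP[y1t y1T] /andP[y2t y2T].
have n1 : near (t :: t' :: T) (y1 ^ (\prod_(s <- t :: t' :: T) s)^-1).
  by rewrite near_slide // rev_cons near_rcons ?y1t // -size_eq0 size_rev.
have chT' : braid_chain (t' :: T) by case/andP: chT.
rewrite -[RHS](IH chT' y1T y2T); move: n1 => /=.
rewrite !(big_cons _ _ t) !(big_cons _ _ t') !invgM !conjgM !conjgKV.
set z1 := y1 ^ _; set z2 := y2 ^ _ => /and3P[_ z1t' _].
have z2t : commb z2 t.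
  rewrite /z2.
  rewrite -(commbJ y2 t (\prod_(s <- T) s)^-1) [t ^ _]commb_conjgV // in y2t.
  by rewrite commbC (chain_tail chT).
rewrite -[LHS](commbJ _ _ t') (commb_conjg z1t') conjgKV.
by rewrite -[z2 in LHS](commb_conjgV z2t) commbJ.
Qed.

(** The turn of the first strand does not move the other strands relative to
    each other.  By induction only the half-twist [t'] next to [t] matters: it
    passes through [t * t' * Q * t' * t], with [Q] the turn of the third strand,
    by two braid relations and because [t] commutes with [Q]. *)
Lemma pure_turn_comm T : braid_chain T ->
  {in behead T, forall s, commute s (pure_turn T)}.
Proof.
rewrite /pure_turn; elim: T => // t [|t' T] IH // chT s.
have {}IH := IH (proj2 (andP chT)).
have turn_cons a T' : \prod_(i <- a :: T') i * \prod_(i <- rev (a :: T')) i =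
    a * ((\prod_(i <- T') i * \prod_(i <- rev T') i) * a).
  by rewrite big_cons rev_cons big_rcons /= !mulgA.
rewrite /= inE turn_cons => /orP[/eqP->{s}|sT]; last first.
  have ts: commute s t.
    by case/andP: chT => /andP[_ /allP/(_ _ sT)/commbP/commute_sym].
  by apply: commuteM => //; apply: commuteM => //; exact: IH.
rewrite turn_cons; set Q := _ * \prod_(i <- rev T) i.
have tQ : commute t Q.
  have /andP[/andP[_ /allP tT] _] := chT.
  apply: commuteM; apply: commute_prodg => s; rewrite ?mem_rev => /tT;
  exact/commbP.
move: Q tQ => Q tQ; have /eqP b3 : braid3 t t' by case/andP: chT => /andP[].
rewrite /commute !mulgA -b3 -(mulgA (t * t') t Q) tQ (mulgA (t * t') Q t).
rewrite -(mulgA _ t t') -(mulgA _ t' t) -(mulgA _ (t * t')) -(mulgA _ (t' * t)).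
by rewrite b3.
Qed.

(** The product in the conclusion is [t * v * t] between the conjugates by
    [t^-1] of the elements before [v] and the conjugates by [t] of those after
    [v]; and [v] commutes with these three factors. *)
Lemma commute_wrap t V : all (fun v => commb v (t * v * t)) V ->
    pairwise (fun v w => commb v (w ^ t)) V ->
  {in V, forall v, commute v (t * \prod_(w <- V) w * t)}.
Proof.
move=> b4V twV v vV; case/splitPr: vV b4V twV => V1 V2.
rewrite all_cat pairwise_cat /= => /and3P[_ /commbP vt _].
rewrite allrel_consr => /and4P[/andP[/allP V1v _] _ /allP vV2 _].
have -> : t * \prod_(w <- V1 ++ v :: V2) w * t =
    (\prod_(w <- V1) w) ^ t^-1 * ((t * v * t) * (\prod_(w <- V2) w) ^ t).
  rewrite big_cat big_cons /= !conjgE invgK !mulgA.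
  by rewrite mulgVK mulgK.
have vV1 w : w \in V1 -> commute v (w ^ t^-1).
  by move=> /V1v; rewrite -(commbJ _ _ t^-1) conjgK commbC => /commbP.
apply: commuteM; last apply: commuteM => //.
  rewrite conjg_prod big_seq; apply: big_rec => [|w z /vV1];
    [exact: commute1 | exact: commuteM].
by rewrite conjg_prod big_seq; apply: big_rec => [|w z /vV2/commbP];
    [exact: commute1 | exact: commuteM].
Qed.

(** The loop around the last puncture, as determined by the sphere relation. *)
Definition closing T V := (pure_turn T * \prod_(v <- V) v)^-1.

(** Write [P = t * Q * t] with [Q] the turn of the second strand, and [A] for
    the product of [V].  Then [Z := P * A] is the inverse of the closing loop,
    and [Z ^ t = Q * (t * A * t)]: as [Q] commutes with [V], everything
    reduces to [commute_wrap]. *)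
Lemma closing_system T V : braid_chain T -> all (near T) V ->
    pairwise (twist T) V ->
  all (near T) (rcons V (closing T V))
    && pairwise (twist T) (rcons V (closing T V)).
Proof.
case: T => [|t T] chT /allP nV twV.
  by elim: (rcons V _) => //= v s /andP[-> ->]; rewrite andbT; elim: s.
set Z := pure_turn (t :: T) * \prod_(v <- V) v; set A := \prod_(v <- V) v in Z.
have Vt : {in V, forall v, commute v (t * A * t)}.
  by apply: commute_wrap => //; apply/allP => v /nV /andP[].
have VT v s : v \in V -> s \in T -> commute v s.
  by move=> /nV /andP[_ /allP vT] /vT/commbP.
have At : commute (t * A * t) A by apply: commute_prodg => v /Vt/commute_sym.
have PT := pure_turn_comm chT; rewrite /= in PT.
set Q := pure_turn T.
have ZE : Z = (t * Q * t) * A.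
  by rewrite /Z /pure_turn big_cons rev_cons big_rcons /= /Q /pure_turn !mulgA.
have comm_Q g : {in T, forall s, commute g s} -> commute g Q.
  move=> gT; apply: commuteM; apply: commute_prodg => // s.
  by rewrite mem_rev => /gT.
have QA : commute Q A.
  by apply: commute_prodg => v vV; apply/commute_sym/comm_Q => s; exact: VT.
have ZtE : Z ^ t = Q * (t * A * t) by rewrite ZE conjgE !mulgA mulVg mul1g.
(* The relation [braid4] of [Z^-1] with [t], which differs from that of [Z]. *)
have Zt : commute Z (t^-1 * Z * t^-1).
  have -> : t^-1 * Z * t^-1 = Q * A ^ t^-1.
    by rewrite ZE conjgE invgK !mulgA mulVg mul1g.
  apply: commuteM.
    apply/commute_sym; rewrite ZE; apply: commuteM => //.
    have -> : t * Q * t = pure_turn (t :: T).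
      by rewrite /pure_turn big_cons rev_cons big_rcons /= /Q /pure_turn !mulgA.
    by apply/commute_sym/comm_Q => s sT; apply/commute_sym/PT.
  apply/commbP; rewrite -(commbJ _ _ t) conjgKV ZtE commbC; apply/commbP.
  by apply: commuteM; exact/commute_sym.
have nearZ : near (t :: T) Z^-1.
  apply/andP; split.
    apply/commbP; have -> : t * Z^-1 * t = (t^-1 * Z * t^-1)^-1.
      by rewrite [RHS]invgM [in RHS]invgM !invgK mulgA.
    by apply/commuteV/commute_sym/commuteV/commute_sym.
  apply/allP => s sT; apply/commbP/commute_sym/commuteV.
  rewrite /Z; apply: commuteM; first exact: PT.
  by apply: commute_prodg => v vV; apply/commute_sym/VT.
rewrite all_rcons nearZ pairwise_rcons twV andbT; apply/andP; split.
  exact/allP.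
apply/allP => v vV; apply/commbP; rewrite conjVg ZtE; apply: commuteV.
by apply: commuteM; [apply: comm_Q => s; exact: VT | exact: Vt].
Qed.

(** The pair [(x ^ y, t)] is conjugate by [y^-1] to [(x, t ^ y^-1)], and
    [t ^ y^-1 = t ^ (y ^ t)] by the relation between [y] and [t]; finally
    [y ^ t] commutes with [x]. *)
Lemma hurwitz_braid4 x y t : braid4 y t -> commb x (y ^ t) ->
  braid4 (x ^ y) t = braid4 x t.
Proof.
move=> /commbP b4; rewrite -[RHS](braid4J _ _ (y ^ t)) => /commb_conjg->.
rewrite -[LHS](braid4J _ _ y^-1) conjgK; congr (braid4 x _).
apply: (mulgI (y ^ t)); rewrite conjgE mulVKg !conjgE invgK.
have {}b4 : y * t * y * t = t * y * t * y by move: b4; rewrite /commute !mulgA.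
by apply: (mulgI t); rewrite !mulgA mulgV !mul1g b4 !mulgK.
Qed.

(** As for [hurwitz_braid4], with [x ^ t^-1] in the role of [y ^ t]. *)
Lemma hurwitzV_braid4 x y t : braid4 x t -> commb x (y ^ t) ->
  braid4 (y ^ x^-1) t = braid4 y t.
Proof.
move=> /commbP b4; rewrite -(commbJ _ _ t^-1) conjgK commbC => yx.
rewrite -[LHS](braid4J _ _ x) conjgKV -[LHS](braid4J _ _ (x ^ t^-1)).
rewrite (commb_conjg yx); congr (braid4 y _).
rewrite !conjgE !invgM !invgK.
have {}b4 : x * t * x * t = t * x * t * x by move: b4; rewrite /commute !mulgA.
transitivity (t * ((x * t * x)^-1 * (t * x * t * x)) * t^-1).
  by rewrite !invgM !mulgA.
by rewrite -b4 mulKg mulgK.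
Qed.

(** The braid group generator of index [p], acting on factorisations. *)
Fixpoint hurwitz p U :=
  match p, U with
  | 0%N, x :: y :: V => y :: x ^ y :: V
  | p.+1%N, x :: V => x :: hurwitz p V
  | _, _ => U
  end.

Fixpoint hurwitzV p U :=
  match p, U with
  | 0%N, x :: y :: V => y ^ x^-1 :: x :: V
  | p.+1%N, x :: V => x :: hurwitzV p V
  | _, _ => U
  end.

Lemma hurwitzK p : cancel (hurwitz p) (hurwitzV p).
Proof.
elim: p => [|p IH] [|x U] //=; last by rewrite IH.
by case: U => // y U /=; rewrite conjgK.
Qed.

Lemma hurwitzVK p : cancel (hurwitzV p) (hurwitz p).
Proof.
elim: p => [|p IH] [|x U] //=; last by rewrite IH.
by case: U => // y U /=; rewrite conjgKV.
Qed.

Lemma hurwitz_cat U1 x y U2 :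
  hurwitz (size U1) (U1 ++ x :: y :: U2) = U1 ++ y :: x ^ y :: U2.
Proof. by elim: U1 => //= z U1 ->. Qed.

Lemma hurwitzV_cat U1 x y U2 :
  hurwitzV (size U1) (U1 ++ x :: y :: U2) = U1 ++ y ^ x^-1 :: x :: U2.
Proof. by elim: U1 => //= z U1 ->. Qed.

(** The group relations of the GDAHA. *)
Definition leg_system T U :=
  [&& braid_chain T, all (near T) U, pairwise (twist T) U &
      \prod_(u <- U) u * pure_turn T == 1].

Lemma twistJl T x y z : twist T x z -> twist T y z -> twist T (x ^ y) z.
Proof.
case: T => //= t T /commbP/commute_sym xz /commbP/commute_sym yz.
by apply/commbP/commute_sym/commute_conj.
Qed.

Lemma twistJr T x y z : twist T x y -> twist T x z -> twist T x (y ^ z).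
Proof.
case: T => //= t T /commbP xy /commbP xz.
by apply/commbP; rewrite conjJg; exact: commute_conj.
Qed.

Lemma twistVl T x y : twist T x y -> twist T x^-1 y.
Proof.
case: T => //= t T /commbP xy.
by apply/commbP/commute_sym/commuteV/commute_sym.
Qed.

Lemma twistVr T x y : twist T x y -> twist T x y^-1.
Proof.
by case: T => //= t T /commbP xy; rewrite conjVg; apply/commbP/commuteV.
Qed.

Lemma nearJ T x y : near T x -> near T y -> twist T x y -> near T (x ^ y).
Proof.
case: T => //= t T /andP[xt /allP xT] /andP[yt /allP yT] xy.
rewrite hurwitz_braid4 // xt; apply/allP => s sT; apply/commbP/commute_sym.
by apply: commute_conj; apply/commute_sym/commbP; [exact: xT | exact: yT].
Qed.

Lemma nearJV T x y : near T x -> near T y -> twist T x y -> near T (y ^ x^-1).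
Proof.
case: T => //= t T /andP[xt /allP xT] /andP[yt /allP yT] xy.
rewrite hurwitzV_braid4 // yt; apply/allP => s sT; apply/commbP/commute_sym.
by apply: commute_conj; last apply: commuteV; apply/commute_sym/commbP;
  [exact: yT | exact: xT].
Qed.

(** After one more half-twist the conjugate loop is [x ^ t^-1] conjugated by
    [t * y * t], two elements that commute with [y]. *)
Lemma twist_hurwitz T x y : near T y -> twist T x y -> twist T y (x ^ y).
Proof.
case: T => //= t T /andP[/commbP b4 _].
rewrite -(commbJ _ _ t^-1) conjgK commbC => /commbP yx.
have -> : (x ^ y) ^ t = (x ^ t^-1) ^ (t * y * t).
  by rewrite -!conjgM !mulgA mulVg mul1g.
by apply/commbP/commute_conj.
Qed.

Lemma twist_hurwitzV T x y : near T x -> twist T x y -> twist T (y ^ x^-1) x.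
Proof.
case: T => //= t T /andP[/commbP b4 _].
rewrite -(commbJ _ _ t^-1) conjgK commbC => yx.
rewrite -(commbJ _ _ x) conjgKV.
suff -> : (x ^ t) ^ x = x ^ t^-1 by [].
apply: (@conjg_inj _ t); rewrite -!conjgM mulVg conjg1.
rewrite mulgA; apply: commb_conjg; exact/commbP.
Qed.

Lemma leg_system_hurwitz T U1 x y U2 :
  leg_system T (U1 ++ x :: y :: U2) -> leg_system T (U1 ++ y :: x ^ y :: U2).
Proof.
rewrite /leg_system !all_cat !pairwise_cat /= !allrel_consr.
move=> /and4P[-> /and4P[-> nx ny ->]] /and3P[/and3P[/allP U1x /allP U1y ->] ->].
move=> /and3P[/andP[xy /allP xU2] /allP yU2 ->].
have -> : \prod_(u <- U1 ++ y :: x ^ y :: U2) u =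
   \prod_(u <- U1 ++ x :: y :: U2) u.
  by rewrite !big_cat !big_cons /= conjgE !mulgA mulgK.
move=> ->; rewrite ny nearJ // twist_hurwitz // !andbT /=.
rewrite -!andbA; apply/and4P; split; apply/allP => z zU //.
- exact: U1y.
- by apply: twistJr; [exact: U1x | exact: U1y].
- exact: yU2.
by apply: twistJl; [exact: xU2 | exact: yU2].
Qed.

Lemma leg_system_hurwitzV T U1 x y U2 :
  leg_system T (U1 ++ x :: y :: U2) ->
  leg_system T (U1 ++ y ^ x^-1 :: x :: U2).
Proof.
rewrite /leg_system !all_cat !pairwise_cat /= !allrel_consr.
move=> /and4P[-> /and4P[-> nx ny ->]] /and3P[/and3P[/allP U1x /allP U1y ->] ->].
move=> /and3P[/andP[xy /allP xU2] /allP yU2 ->].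
have -> : \prod_(u <- U1 ++ y ^ x^-1 :: x :: U2) u =
   \prod_(u <- U1 ++ x :: y :: U2) u.
  by rewrite !big_cat !big_cons /= conjgE invgK !mulgA mulgVK.
move=> ->; rewrite nx nearJV // twist_hurwitzV // !andbT /=.
rewrite -!andbA; apply/and4P; split; apply/allP => z zU //.
- by apply: twistJr; [exact: U1y | apply: twistVr; exact: U1x].
- exact: U1x.
- by apply: twistJl; [exact: yU2 | apply: twistVl; exact: xU2].
exact: xU2.
Qed.

(** The group relations of the Hecke algebra: [U] is [S_1] followed by the
    loops of the last strand. *)
Definition hecke_system T U :=
  braid_chain T &&
  if U is x :: ys then
    [&& near T x, all (near (rev T)) ys, nilp T || all (commb x) ys
      & pairwise (twist_last T) ys]
  else true.

(** The word [S_0]. *)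
Definition hecke_word T U :=
  \prod_(x <- take 1 U) x * \prod_(t <- T) t * \prod_(y <- behead U) y
    * \prod_(t <- rev T) t.

Definition slide g U :=
  if U is x :: ys then x :: [seq y ^ g | y <- ys] else [::].

Definition to_legs T U :=
  let V := slide (\prod_(t <- T) t)^-1 U in rcons V (closing T V).

Definition of_legs T U := slide (\prod_(t <- T) t) (take (size U).-1 U).

Lemma slideK g : cancel (slide g) (slide g^-1).
Proof. by case=> //= x U; rewrite mapK //; exact: conjgK. Qed.

Lemma slideVK g : cancel (slide g^-1) (slide g).
Proof. by case=> //= x U; rewrite mapK //; exact: conjgKV. Qed.

Lemma to_legsK T : cancel (to_legs T) (of_legs T).
Proof.
move=> U; rewrite /of_legs /to_legs size_rcons /= -cats1 take_size_cat //.
exact: slideVK.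
Qed.

Lemma of_legsK T U : (0 < size U)%N -> \prod_(u <- U) u * pure_turn T = 1 ->
  to_legs T (of_legs T U) = U.
Proof.
case: (lastP U) => // V w _; rewrite /to_legs /of_legs size_rcons /=.
rewrite -cats1 take_size_cat // slideK cats1 big_rcons /= => VwP.
by congr rcons; apply/mulg1_eq; rewrite -mulgA -(mulg1_eq VwP) mulVg.
Qed.

Lemma leg_system_closing T V : leg_system T (rcons V (closing T V)) =
  [&& braid_chain T, all (near T) V & pairwise (twist T) V].
Proof.
rewrite /leg_system; apply/idP/idP.
  by rewrite all_rcons pairwise_rcons => /and4P[-> /andP[_ ->] /andP[_ ->] _].
move=> /and3P[chT nV tV].
have /andP[-> ->] := closing_system chT nV tV.
by rewrite chT big_rcons /= /closing invgM mulVKg mulVg eqxx.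
Qed.

(** The Hecke relations are the relations between all the GDAHA loops
    but the last one. *)
Lemma slide_system T U : hecke_system T U =
  [&& braid_chain T, all (near T) (slide (\prod_(t <- T) t)^-1 U)
    & pairwise (twist T) (slide (\prod_(t <- T) t)^-1 U)].
Proof.
rewrite /hecke_system; case chT: (braid_chain T) => //=.
case: U => //= x U; rewrite !all_map pairwise_map -andbA.
case nx: (near T x) => //=.
have nearE : all (preim (conjg^~ (\prod_(t <- T) t)^-1) (near T)) U
    = all (near (rev T)) U by apply: eq_all => y; exact: near_slide.
rewrite {}nearE; case ys: (all _ U) => //=; move/allP: ys => ys.
congr andb; last first.
  elim: U ys => //= y U IH ys; rewrite IH => [|z zU]; last first.
    by apply: ys; rewrite inE zU orbT.
  congr andb; apply: eq_in_all => z zU /=.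
  by rewrite twist_slide // ys // inE ?eqxx ?zU ?orbT.
case: (eqVneq T [::]) => [->|T0]; first by elim: U {ys}.
rewrite nilpE (negPf T0); apply: eq_in_all => y yU.
by rewrite /= near_twist_slide.
Qed.

(** [S_0] is the inverse of the last loop up to conjugacy, so that its
    eigenvalues are the inverses of the parameters of the last leg. *)
Lemma closing_slide T U : closing T (slide (\prod_(t <- T) t)^-1 U) =
  (hecke_word T U)^-1 ^ (pure_turn T)^-1.
Proof.
rewrite conjVg /closing /hecke_word /pure_turn; congr (_^-1).
set c := \prod_(t <- T) t; set r := \prod_(t <- rev T) t.
case: U => [|x U] /=.
  by rewrite !big_nil mul1g !mulg1 commb_conjgV ?commb_refl.
rewrite big_cons take0 big_seq1 big_map -(conjg_prod _ _ idfun).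
by rewrite !conjgE !invgK !invgM !mulgA mulgK.
Qed.

End BraidSystems.

Section Naturality.
Local Open Scope group_scope.
Variables (G H : groupType) (f : UMagmaMorphism.type G H).
Implicit Types T U : seq G.

Lemma map_prod U : f (\prod_(u <- U) u) = \prod_(u <- map f U) u.
Proof. by rewrite big_map gmulf_prod. Qed.

Lemma map_slide g U : map f (slide g U) = slide (f g) (map f U).
Proof.
case: U => //= x U; congr (_ :: _); rewrite -!map_comp; apply: eq_map => y /=.
exact: gmulfJ.
Qed.

Lemma map_closing T U : f (closing T U) = closing (map f T) (map f U).
Proof. by rewrite gmulfV !gmulfM !map_prod map_rev. Qed.

Lemma map_to_legs T U : map f (to_legs T U) = to_legs (map f T) (map f U).
Proof. by rewrite map_rcons map_closing !map_slide gmulfV map_prod. Qed.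

Lemma map_of_legs T U : map f (of_legs T U) = of_legs (map f T) (map f U).
Proof. by rewrite /of_legs map_slide map_prod size_map map_take. Qed.

Lemma map_hurwitz p U : map f (hurwitz p U) = hurwitz p (map f U).
Proof.
elim: p U => [|p IH] [|x U] //=; last by rewrite IH.
by case: U => //= y U; rewrite gmulfJ.
Qed.

Lemma map_hurwitzV p U : map f (hurwitzV p U) = hurwitzV p (map f U).
Proof.
elim: p U => [|p IH] [|x U] //=; last by rewrite IH.
by case: U => //= y U; rewrite gmulfJ gmulfV.
Qed.

End Naturality.

Import GRing.Theory.
Local Open Scope ring_scope.

(** * The group of units and its action on terms *)

Section Units.
Variable X : pzRingType.

(** Rings without decidable invertibility: a unit carries its inverse. *)
Record units : Type := Units {
  upair : X * X;
  upairP : (upair.1 * upair.2 == 1) && (upair.2 * upair.1 == 1)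
}.

HB.instance Definition _ := [isSub for upair].
HB.instance Definition _ := [Choice of units by <:].

Definition uval (x : units) : X := (upair x).1.
Definition uinv (x : units) : X := (upair x).2.

Lemma uvalV x : uval x * uinv x = 1.
Proof. by have /andP[/eqP] := upairP x. Qed.

Lemma uvalVl x : uinv x * uval x = 1.
Proof. by have /andP[_ /eqP] := upairP x. Qed.

Lemma uval_inj : injective uval.
Proof.
move=> x y xy; apply: val_inj; rewrite /= (surjective_pairing (upair x)).
rewrite (surjective_pairing (upair y)); congr pair => //; rewrite -/(uinv _).
by rewrite -[LHS]mulr1 -(uvalV y) -xy mulrA uvalVl mul1r.
Qed.

Lemma mk_units_subproof (a b : X) : a * b = 1 -> b * a = 1 ->
  ((a, b).1 * (a, b).2 == 1) && ((a, b).2 * (a, b).1 == 1).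
Proof. by move=> /eqP-> /eqP->. Qed.

Definition mk_units a b (ab : a * b = 1) (ba : b * a = 1) : units :=
  Units (mk_units_subproof ab ba).

Definition unit_one : units := mk_units (mul1r 1) (mul1r 1).

Definition unit_inv (x : units) : units := mk_units (uvalVl x) (uvalV x).

Lemma unit_mulV (x y : units) : uval x * uval y * (uinv y * uinv x) = 1.
Proof. by rewrite mulrA -(mulrA (uval x)) uvalV mulr1 uvalV. Qed.

Lemma unit_mulVl (x y : units) : uinv y * uinv x * (uval x * uval y) = 1.
Proof. by rewrite mulrA -(mulrA (uinv y)) uvalVl mulr1 uvalVl. Qed.

Definition unit_mul (x y : units) : units :=
  mk_units (unit_mulV x y) (unit_mulVl x y).

Lemma unit_mulA : associative unit_mul.
Proof. by move=> x y z; apply: uval_inj; rewrite /uval /= mulrA. Qed.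

Lemma unit_mul1 : left_id unit_one unit_mul.
Proof. by move=> x; apply: uval_inj; rewrite /uval /= mul1r. Qed.

Lemma unit_1mul : right_id unit_one unit_mul.
Proof. by move=> x; apply: uval_inj; rewrite /uval /= mulr1. Qed.

Lemma unit_mulgV : left_inverse unit_one unit_inv unit_mul.
Proof. by move=> x; apply: uval_inj; exact: uvalVl. Qed.

Lemma unit_mulVg : right_inverse unit_one unit_inv unit_mul.
Proof. by move=> x; apply: uval_inj; exact: uvalV. Qed.

HB.instance Definition _ := isGroup.Build units
  unit_mulA unit_mul1 unit_1mul unit_mulgV unit_mulVg.

Lemma uval1 : uval 1%g = 1. Proof. by []. Qed.
Lemma uvalM x y : uval (x * y)%g = uval x * uval y. Proof. by []. Qed.
Lemma uvalVE x : uval (x^-1)%g = uinv x. Proof. by []. Qed.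

Lemma uval_prod U : uval (\prod_(u <- U) u)%g = \prod_(u <- U) uval u.
Proof. exact: (big_morph uval uvalM uval1). Qed.

End Units.

Section UnitsMap.
Variables (X Y : pzRingType) (f : {rmorphism X -> Y}).

Lemma umap_subproof (x : units X) :
  (f (uval x) * f (uinv x) = 1) * (f (uinv x) * f (uval x) = 1).
Proof. by rewrite -!rmorphM uvalV uvalVl rmorph1. Qed.

Definition umap (x : units X) : units Y :=
  mk_units (umap_subproof x).1 (umap_subproof x).2.

Lemma uval_umap x : uval (umap x) = f (uval x). Proof. by []. Qed.

Lemma umapM : {morph umap : x y / (x * y)%g}.
Proof. by move=> x y; apply: uval_inj; rewrite uvalM !uval_umap rmorphM. Qed.

Lemma umap1 : umap 1%g = 1%g.
Proof. by apply: uval_inj; rewrite uval_umap rmorph1. Qed.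

HB.instance Definition _ := isUMagmaMorphism.Build (units X) (units Y) umap
  (umap1, umapM).

End UnitsMap.

Section Evaluation.
Variables (R G : Type) (Y : pzRingType) (e : R -> Y) (y : G -> units Y).

Fixpoint eval (t : term R G) : Y :=
  match t with
  | Cst a => e a
  | Gen g => uval (y g)
  | GenV g => uinv (y g)
  | Opp t => - eval t
  | Add s t => eval s + eval t
  | Mul s t => eval s * eval t
  end.

End Evaluation.

Section PalgLift.
Variables (R : comPzRingType) (G : Type) (rel : term R G -> term R G -> Prop).

Definition punit (g : G) : units (palg rel) :=
  mk_units (pgenVr rel g) (pgenVl rel g).

Lemma eval_pcls (t : term R G) : eval (@pcst _ _ rel) punit t = pcls rel t.
Proof.
by elim: t => //= [t ->|s -> t ->|s -> t ->]; rewrite ?pclsN ?pclsD ?pclsM.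
Qed.

Section Lift.
Variables (Y : pzRingType) (e : {rmorphism R -> Y}) (y : G -> units Y).
Hypothesis e_central : forall a z, e a * z = z * e a.
Hypothesis y_rel : forall s t, rel s t -> eval e y s = eval e y t.

Lemma eval_cong s t : cong rel s t -> eval e y s = eval e y t.
Proof.
elim=> {s t} //=.
- by move=> s t u _ -> _ ->.
- by move=> s s' _ ->.
- by move=> s s' t t' _ -> _ ->.
- by move=> s s' t t' _ -> _ ->.
- by move=> s t u; rewrite addrA.
- by move=> s t; rewrite addrC.
- by move=> s; rewrite rmorph0 add0r.
- by move=> s; rewrite rmorph0 addNr.
- by move=> s t u; rewrite mulrA.
- by move=> s; rewrite rmorph1 mul1r.
- by move=> s; rewrite rmorph1 mulr1.
- by move=> s t u; rewrite mulrDl.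
- by move=> s t u; rewrite mulrDr.
- by move=> a b; rewrite rmorphD.
- by move=> a b; rewrite rmorphM.
- by move=> g; rewrite rmorph1 uvalV.
- by move=> g; rewrite rmorph1 uvalVl.
Qed.

Definition plift (u : palg rel) : Y := eval e y (repr u).

Lemma pliftE t : plift (pcls rel t) = eval e y t.
Proof. exact/eval_cong/repr_cong. Qed.

Lemma plift_zmod : zmod_morphism plift.
Proof.
by move=> u v; rewrite (pcls_surj u) (pcls_surj v) -pclsN -pclsD !pliftE.
Qed.

Lemma plift_monoid : monoid_morphism plift.
Proof.
split; first by rewrite -[1]/(pcls rel (Cst 1)) pliftE /= rmorph1.
by move=> u v; rewrite (pcls_surj u) (pcls_surj v) -pclsM !pliftE.
Qed.

HB.instance Definition _ :=
  GRing.isZmodMorphism.Build (palg rel) Y plift plift_zmod.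
HB.instance Definition _ :=
  GRing.isMonoidMorphism.Build (palg rel) Y plift plift_monoid.

Lemma palg_lift : exists f : {rmorphism palg rel -> Y},
  (forall a, f (algmap a) = e a) /\ forall g, umap f (punit g) = y g.
Proof.
exists plift; split=> [a|g]; first exact: pliftE.
by apply: uval_inj; rewrite uval_umap /= pliftE.
Qed.

End Lift.

(** Comparing the images of the letters as units takes care of their formal
    inverses. *)
Lemma palg_hom_ext (Y : pzRingType) (f g : {rmorphism palg rel -> Y}) :
  (forall a, f (algmap a) = g (algmap a)) ->
  (forall i, umap f (punit i) = umap g (punit i)) -> f =1 g.
Proof.
move=> fg_cst fg_gen u; rewrite (pcls_surj u).
elim: (repr u) => [a|i|i|t IH|s IHs t IHt|s IHs t IHt].
- exact: fg_cst.
- exact: (congr1 (@uval Y) (fg_gen i)).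
- exact: (congr1 (@uinv Y) (fg_gen i)).
- by rewrite pclsN !rmorphN IH.
- by rewrite pclsD !rmorphD IHs IHt.
- by rewrite pclsM !rmorphM IHs IHt.
Qed.

End PalgLift.

(** * Presentations and universal properties *)

Definition alghom (B : comPzRingType) (X Y : pzAlgType B) (f : X -> Y) :=
  forall b : B, f (algmap b) = algmap b.

Section Presentations.
Variables (A B : comPzRingType) (phi : {rmorphism A -> B}) (G : Type).
Variable rel : term A G -> term A G -> Prop.

Definition satisfies (Y : pzAlgType B) (y : G -> units Y) :=
  forall s t, rel s t ->
    eval (fun a => algmap (phi a)) y s = eval (fun a => algmap (phi a)) y t.

(** The algebra [X] with the letters [x] has the universal property of the base
    change along [phi] of the algebra presented by [rel]. *)
Definition is_presentation (X : pzAlgType B) (x : G -> units X) :=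
  [/\ satisfies x,
      forall (Y : pzAlgType B) (y : G -> units Y), satisfies y ->
        exists f : {rmorphism X -> Y}, alghom f /\ forall g, umap f (x g) = y g
    & forall (Y : pzAlgType B) (f g : {rmorphism X -> Y}),
        alghom f -> alghom g ->
        (forall i, umap f (x i) = umap g (x i)) -> f =1 g].

End Presentations.

Lemma palg_presentation (B : comPzRingType) (G : Type)
    (rel : term B G -> term B G -> Prop) :
  is_presentation idfun rel (@punit _ _ rel : G -> units (palg rel)).
Proof.
split.
- by move=> s t st; rewrite !eval_pcls; apply/pclsP; exact: cong_rel.
- move=> Y y yrel; have [f [fc fg]] := palg_lift (@algmap_central B Y) yrel.
  by exists f.
move=> Y f g fB gB; apply: palg_hom_ext => a; rewrite fB; exact/esym/gB.
Qed.

Section BaseChange.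
Variables (A B : comPzRingType) (phi : {rmorphism A -> B}) (H : pzAlgType A).

Definition tincl (h : H) : base_change phi H := tpure phi 1 h.

Lemma tincl_zmod : zmod_morphism tincl.
Proof.
by move=> a b; rewrite -[in RHS](subrK b a) [in RHS]/tincl tpureDr addrK.
Qed.

Lemma tincl_monoid : monoid_morphism tincl.
Proof. by split=> // a b; rewrite /tincl tpureM mulr1. Qed.

HB.instance Definition _ :=
  GRing.isZmodMorphism.Build H (base_change phi H) tincl tincl_zmod.
HB.instance Definition _ :=
  GRing.isMonoidMorphism.Build H (base_change phi H) tincl tincl_monoid.

Lemma tincl_algmap a : tincl (algmap a) = algmap (phi a).
Proof. by rewrite /tincl -[algmap a]mulr1 tpure_balanced mul1r. Qed.

Lemma tpure_tincl b h : tpure phi b h = algmap b * tincl h.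
Proof. by rewrite [RHS]tpureM mulr1 mul1r. Qed.

Lemma base_change_hom_ext (Y : pzRingType)
    (f g : {rmorphism base_change phi H -> Y}) :
  (forall b, f (algmap b) = g (algmap b)) ->
  (forall h, f (tincl h) = g (tincl h)) -> f =1 g.
Proof.
move=> fgB fgH; elim/base_change_ind => [b h||u IH|u v IHu IHv].
- by rewrite tpure_tincl !rmorphM fgB fgH.
- by rewrite !rmorph0.
- by rewrite !rmorphN IH.
- by rewrite !rmorphD IHu IHv.
Qed.

Section Lift.
Variables (Y : pzAlgType B) (h : {rmorphism H -> Y}).
Hypothesis h_semi : forall a, h (algmap a) = algmap (phi a).

Let F (b : B) (x : H) : Y := algmap b * h x.

Let FDl b b' x : F (b + b') x = F b x + F b' x.
Proof. by rewrite /F rmorphD mulrDl. Qed.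

Let FDr b x x' : F b (x + x') = F b x + F b x'.
Proof. by rewrite /F rmorphD mulrDr. Qed.

Let FZ b a x : F b (algmap a * x) = F (b * phi a) x.
Proof. by rewrite /F !rmorphM h_semi mulrA. Qed.

Definition blift (u : base_change phi H) : Y := tlift F u.

Lemma blift_zmod : zmod_morphism blift.
Proof.
by move=> u v; rewrite /blift (tliftD FDl FDr FZ) (tliftN FDl FDr FZ).
Qed.

Lemma blift_pure b x : blift (tpure phi b x) = algmap b * h x.
Proof. exact: (tlift_pure FDl FDr FZ). Qed.

HB.instance Definition _ :=
  GRing.isZmodMorphism.Build (base_change phi H) Y blift blift_zmod.

Lemma blift_monoid : monoid_morphism blift.
Proof.
split=> [|u v]; first by rewrite [LHS]blift_pure !rmorph1 mulr1.
elim/base_change_ind: u => [b x||u IH|u u' IHu IHv].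
- elim/base_change_ind: v => [b' x'||v IH|v v' IHu IHv].
  + rewrite tpureM !blift_pure !rmorphM -!mulrA; congr (_ * _).
    by rewrite !mulrA algmap_central.
  + by rewrite !(mulr0, raddf0).
  + by rewrite !(mulrN, raddfN) /= IH.
  + by rewrite !(mulrDr, raddfD) /= IHu IHv.
- by rewrite mul0r raddf0 mul0r.
- by rewrite !(mulNr, raddfN) /= IH.
- by rewrite !(mulrDl, raddfD) /= IHu IHv.
Qed.

HB.instance Definition _ :=
  GRing.isMonoidMorphism.Build (base_change phi H) Y blift blift_monoid.

Lemma base_change_lift : exists f : {rmorphism base_change phi H -> Y},
  alghom f /\ forall x, f (tincl x) = h x.
Proof.
exists blift; split=> [b|x]; first by rewrite [LHS]blift_pure rmorph1 mulr1.
by rewrite [LHS]blift_pure rmorph1 mul1r.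
Qed.

End Lift.

End BaseChange.

Lemma eval_comp (R G : Type) (Y Z : pzRingType) (e : R -> Y) (y : G -> units Y)
    (f : {rmorphism Y -> Z}) t :
  eval (f \o e) (umap f \o y) t = f (eval e y t).
Proof.
elim: t => //= [t ->|s -> t ->|s -> t ->];
by rewrite ?rmorphN ?rmorphD ?rmorphM.
Qed.

Lemma base_change_presentation (A B : comPzRingType) (phi : {rmorphism A -> B})
    (G : Type) (rel : term A G -> term A G -> Prop) :
  is_presentation phi rel
    (umap (@tincl A B phi (palg rel)) \o @punit _ _ rel
       : G -> units (base_change phi (palg rel))).
Proof.
split.
- move=> s t st.
  have eE : (fun a => algmap (phi a)) =
      @tincl A B phi (palg rel) \o @pcst _ _ rel.
    by apply: funext => a; rewrite -tincl_algmap.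
  rewrite eE !eval_comp; congr (tincl _ _); rewrite !eval_pcls.
  by apply/pclsP/cong_rel.
- move=> Y y yrel.
  have ec a (z : Y) : (algmap \o phi) a * z = z * (algmap \o phi) a.
    exact: algmap_central.
  have [h [hc hg]] := palg_lift ec yrel.
  have [f [fB fh]] := base_change_lift hc.
  exists f; split=> // g; rewrite -hg; apply: uval_inj; exact: fh.
move=> Y f g fB gB fg.
apply: base_change_hom_ext => [b|]; first by rewrite fB gB.
apply: (@palg_hom_ext _ _ _ Y (f \o @tincl A B phi (palg rel))
   (g \o @tincl A B phi (palg rel))) => [a|i] /=.
  by rewrite !tincl_algmap fB gB.
by apply: uval_inj; exact: (congr1 (@uval Y) (fg i)).
Qed.

Section Universal.
Variable B : comPzRingType.

(** A pair [(U, T)]: loops and half-twists. *)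
Definition datum (X : pzRingType) := (seq (units X) * seq (units X))%type.

Definition dmap (X Y : pzRingType) (f : {rmorphism X -> Y}) (d : datum X) :
  datum Y := (map (umap f) d.1, map (umap f) d.2).

(** The functor [Phi] is corepresented by [X], with generic element [x]. *)
Definition universal (Phi : forall Y : pzAlgType B, datum Y -> Prop)
    (X : pzAlgType B) (x : datum X) :=
  [/\ Phi X x,
      forall (Y : pzAlgType B) y, Phi Y y ->
        exists f : {rmorphism X -> Y}, alghom f /\ dmap f x = y
    & forall (Y : pzAlgType B) (f g : {rmorphism X -> Y}),
        alghom f -> alghom g -> dmap f x = dmap g x -> f =1 g].

Lemma dmap_comp (X Y Z : pzRingType) (f : {rmorphism X -> Y})
    (g : {rmorphism Y -> Z}) d : dmap g (dmap f d) = dmap (g \o f) d.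
Proof.
by rewrite /dmap /= -!map_comp; congr pair; apply: eq_map => x; exact: uval_inj.
Qed.

Lemma dmap_id (X : pzRingType) (d : datum X) : dmap idfun d = d.
Proof.
case: d => U T; rewrite /dmap /=; congr pair; rewrite -[RHS]map_id;
by apply: eq_map => x; exact: uval_inj.
Qed.

Lemma universal_iso Phi (X Y : pzAlgType B) (x : datum X) (y : datum Y) :
  universal Phi x -> universal Phi y -> alg_isomorphic X Y.
Proof.
move=> [Px liftx extx] [Py lifty exty].
have [f [fB fx]] := liftx _ _ Py; have [g [gB gy]] := lifty _ _ Px.
exists f; split=> //; exists g => [u|v].
  rewrite -[g _]/((g \o f) u); apply: (extx X (g \o f) idfun) => // [b|] /=.
    by rewrite fB gB.
  by rewrite -dmap_comp fx gy dmap_id.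
rewrite -[f _]/((f \o g) v); apply: (exty Y (f \o g) idfun) => // [b|] /=.
  by rewrite gB fB.
by rewrite -dmap_comp gy fx dmap_id.
Qed.

(** Naturality of [F] carries the classifying morphisms over; naturality of
    [F'] recovers the images of [x] from those of [F X x]. *)
Lemma universal_change (Phi Psi : forall Y : pzAlgType B, datum Y -> Prop)
    (F F' : forall Y : pzAlgType B, datum Y -> datum Y) :
  (forall (X Y : pzAlgType B) (f : {rmorphism X -> Y}) d,
     dmap f (F X d) = F Y (dmap f d)) ->
  (forall (X Y : pzAlgType B) (f : {rmorphism X -> Y}) d,
     dmap f (F' X d) = F' Y (dmap f d)) ->
  (forall Y d, Phi Y d -> Psi Y (F Y d) /\ F' Y (F Y d) = d) ->
  (forall Y d, Psi Y d -> Phi Y (F' Y d) /\ F Y (F' Y d) = d) ->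
  forall (X : pzAlgType B) (x : datum X), universal Phi x ->
  universal Psi (F X x).
Proof.
move=> natF natF' PhiF PsiF' X x [Px liftx extx]; have [Fx F'Fx] := PhiF _ _ Px.
split=> // [Y y Py|Y f g fB gB fg].
  have [F'y FF'y] := PsiF' _ _ Py; have [f [fB fx]] := liftx _ _ F'y.
  by exists f; rewrite natF fx.
by apply: extx => //; rewrite -F'Fx !natF' fg.
Qed.

(** Passage from families indexed by the letters of a presentation to lists. *)
Lemma presentation_universal (A : comPzRingType) (phi : {rmorphism A -> B})
    (G : Type) (rel : term A G -> term A G -> Prop)
    (Phi : forall Y : pzAlgType B, datum Y -> Prop)
    (D : forall Y : pzAlgType B, (G -> units Y) -> datum Y) :
  (forall (X Y : pzAlgType B) (f : {rmorphism X -> Y}) x,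
     dmap f (D X x) = D Y (umap f \o x)) ->
  (forall (Y : pzAlgType B) (y z : G -> units Y), D Y y = D Y z -> y =1 z) ->
  (forall Y y, satisfies phi rel y <-> Phi Y (D Y y)) ->
  (forall Y d, Phi Y d -> exists y, D Y y = d) ->
  forall (X : pzAlgType B) (x : G -> units X), is_presentation phi rel x ->
  universal Phi (D X x).
Proof.
move=> natD injD relP surD X x [xrel liftx extx].
split=> [|Y d Pd|Y f g fB gB]; first exact/relP.
  have [y yd] := surD _ _ Pd; move: Pd; rewrite -yd => /relP/liftx[f [fB fx]].
  by exists f; split=> //; rewrite natD; congr D; exact: funext.
by rewrite !natD => /injD; exact: extx.
Qed.

End Universal.

(** * Eigenvalue relations and the two systems of relations *)

Lemma all2_cat (S T : Type) (r : S -> T -> bool) s1 s2 t1 t2 :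
  size s1 = size t1 ->
  all2 r (s1 ++ s2) (t1 ++ t2) = all2 r s1 t1 && all2 r s2 t2.
Proof.
by elim: s1 t1 => [|x s1 IH] [|y t1] //= [/IH ->]; rewrite andbA.
Qed.

Section Annihilators.
Variables (B : comPzRingType) (Y : pzAlgType B).
Implicit Types (x g : units Y) (L : seq B).

Definition annihilates L x := \prod_(b <- L) (uval x - algmap b) == 0 :> Y.

Lemma annihilatesJ L x g : annihilates L (x ^ g)%g = annihilates L x.
Proof.
have subJ b : uval (x ^ g)%g - algmap b = uinv g * (uval x - algmap b) * uval g.
  rewrite mulrBr mulrBl -mulrA -algmap_central -(mulrA _ (uinv g)) uvalVl mulr1.
  by [].
have prodJ M : \prod_(b <- M) (uval (x ^ g)%g - algmap b) =
    uinv g * (\prod_(b <- M) (uval x - algmap b)) * uval g.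
  elim: M => [|b M IH]; first by rewrite !big_nil mulr1 uvalVl.
  by rewrite !big_cons IH subJ !mulrA -(mulrA _ (uval g) (uinv g)) uvalV mulr1.
rewrite /annihilates prodJ; apply/eqP/eqP => [|->]; last by rewrite mulr0 mul0r.
move=> /(congr1 (fun z => uval g * z * uinv g)).
by rewrite !mulrA uvalV mul1r -mulrA uvalV mulr1 mulr0 mul0r.
Qed.

(** If [b * b' = 1], then [x^-1 - b = - b * x^-1 * (x - b')], where
    [b] is central and the other two factors commute with [x]. *)
Lemma annihilates_inv (I : eqType) (r : seq I) (F F' : I -> B) x :
  {in r, forall i, F i * F' i = 1} ->
  annihilates [seq F i | i <- r] x^-1%g = annihilates [seq F' i | i <- r] x.
Proof.
move=> FF'; rewrite /annihilates !big_map.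
have flip y G G' : {in r, forall i, G i * G' i = 1} ->
    \prod_(i <- r) (uval y - algmap (G' i)) = 0 ->
    \prod_(i <- r) (uval y^-1%g - algmap (G i)) = 0 :> Y.
  move=> GG' P0; suff -> : \prod_(i <- r) (uval y^-1%g - algmap (G i)) =
      algmap (\prod_(i <- r) - G i) * (uinv y ^+ size r
       * \prod_(i <- r) (uval y - algmap (G' i))) by rewrite P0 !mulr0.
  elim: r {P0 FF'} GG' => [|i s IH] GG'.
    by rewrite !big_nil rmorph1 !mulr1.
  have {}IH := IH (fun j js => GG' j (@mem_behead _ (i :: s) j js)).
  rewrite !big_cons IH uvalVE /=.
  have -> : uinv y - algmap (G i) =
      algmap (- G i) * (uinv y * (uval y - algmap (G' i))).
    rewrite mulrBr uvalVl -algmap_central mulrBr mulr1 mulrA -rmorphM mulNr.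
    rewrite GG' ?mem_head //.
    by rewrite !rmorphN rmorph1 mulN1r opprK addrC.
  have cy : GRing.comm (uval y - algmap (G' i)) (uinv y ^+ size s).
    apply/commrX/commr_sym/commrB; last exact/commr_sym/algmap_central.
    by rewrite /GRing.comm uvalV uvalVl.
  rewrite rmorphM -!mulrA; congr (_ * _); rewrite exprS.
  rewrite [uval y - _ in LHS]lock mulrA -lock.
  rewrite (mulrA _ (algmap _)) -algmap_central -!mulrA; congr (_ * _).
  by rewrite !mulrA -(mulrA _ (uval y - _)) cy !mulrA.
apply/eqP/eqP; last by apply: flip.
rewrite -{2}[x]invgK; apply: flip => i ir; by rewrite mulrC FF'.
Qed.

Lemma annihilates_all2J g (L : seq (seq B)) (U : seq (units Y)) :
  all2 annihilates L [seq (u ^ g)%g | u <- U] = all2 annihilates L U.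
Proof.
by elim: L U => [|l L IH] [|u U] //=; rewrite IH annihilatesJ.
Qed.

Lemma annihilates_slide g (L : seq (seq B)) (U : seq (units Y)) :
  all2 annihilates L (slide g U) = all2 annihilates L U.
Proof. by case: L U => [|l L] [|u U] //=; rewrite annihilates_all2J. Qed.

Lemma annihilates_rcons (L : seq (seq B)) l (U : seq (units Y)) u :
  size L = size U ->
  all2 annihilates (rcons L l) (rcons U u) =
  all2 annihilates L U && annihilates l u.
Proof.
by move=> LU; rewrite -!cats1 all2_cat //= andbT.
Qed.

End Annihilators.

Section Systems.
Variables (B : comPzRingType) (n : nat) (Q : seq B).

(** The relations of the GDAHA with list of legs [L], each given by
    the parameters of its vertices; [Q] lists the two eigenvalues of the
    half-twists. *)
Definition gdaha_relations (L : seq (seq B)) (Y : pzAlgType B)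
    (d : datum Y) : Prop :=
  [/\ size d.2 = n.-1, leg_system d.2 d.1, all2 (@annihilates B Y) L d.1
    & all (annihilates Q) d.2].

(** The relations of the Hecke algebra; [l0] lists the inverses of the
    eigenvalues of [S_0]. *)
Definition hecke_relations (L : seq (seq B)) (l0 : seq B) (Y : pzAlgType B)
    (d : datum Y) : Prop :=
  [/\ size d.2 = n.-1, hecke_system d.2 d.1, all2 (@annihilates B Y) L d.1,
      annihilates l0 (hecke_word d.2 d.1)^-1%g & all (annihilates Q) d.2].

(** The isomorphism for the leg order in which [S_0] gives the last leg. *)
Lemma hecke_gdaha_universal L l0 (X : pzAlgType B) (x : datum X) :
  universal (@hecke_relations L l0) x ->
  universal (@gdaha_relations (rcons L l0)) (to_legs x.2 x.1, x.2).
Proof.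
apply: (@universal_change B _ _ (fun Y d => (to_legs d.2 d.1, d.2))
  (fun Y d => (of_legs d.2 d.1, d.2))) => [Z Y f|Z Y f|Y|Y] [U T] /=.
- by rewrite /dmap /= map_to_legs.
- by rewrite /dmap /= map_of_legs.
- move=> [/= sT sys LU l0w QT]; rewrite to_legsK; split=> //; split=> //=.
    by rewrite leg_system_closing -slide_system.
  rewrite annihilates_rcons ?annihilates_slide ?LU ?closing_slide
    ?annihilatesJ //.
  move: LU; rewrite all2E => /andP[/eqP-> _].
  by case: (U) => //= u V; rewrite size_map.
move=> [/= sT sys LU QT].
have sU : size U = (size L).+1.
  by move: LU; rewrite all2E size_rcons => /andP[/eqP].
have prodU : (\prod_(u <- U) u * pure_turn T)%g = 1%g.
  by case/and4P: sys => _ _ _ /eqP.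
have UE : to_legs T (of_legs T U) = U by rewrite of_legsK ?sU.
split; last by rewrite UE.
have sV : size L = size (slide (\prod_(t <- T) t)^-1%g (of_legs T U)).
  by move: sU; rewrite -{1}UE size_rcons => -[].
move: sys LU; rewrite -UE leg_system_closing -slide_system => sys.
rewrite annihilates_rcons // annihilates_slide closing_slide annihilatesJ.
by rewrite to_legsK => /andP[LU l0w]; split.
Qed.

(** Conjugate units have the same equation, so that a Hurwitz move
    exchanges two neighbouring legs. *)
Lemma gdaha_relations_swap L1 a b L2 (X : pzAlgType B) (x : datum X) :
  universal (@gdaha_relations (L1 ++ a :: b :: L2)) x ->
  universal (@gdaha_relations (L1 ++ b :: a :: L2))
    (hurwitz (size L1) x.1, x.2).
Proof.
have split2 (Y : pzAlgType B) c d (U : seq (units Y)) :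
    all2 (@annihilates B Y) (L1 ++ c :: d :: L2) U ->
  exists U1 u v U2, [/\ U = U1 ++ u :: v :: U2, size U1 = size L1 &
    [/\ all2 (@annihilates B Y) L1 U1, annihilates c u, annihilates d v
      & all2 (@annihilates B Y) L2 U2]].
  elim: L1 U => [|l L IH] [|u U] //=.
    case: U => [|v U] /=; first by rewrite andbF.
    by case/and3P=> cu dv LU; exists [::], u, v, U.
  case/andP=> lu /IH[U1 [v [w [U2 [-> sU1 [LU1 cv dw LU2]]]]]].
  exists (u :: U1), v, w, U2; split=> //=; first by rewrite sU1.
  by rewrite lu.
apply: (@universal_change B _ _ (fun Y d => (hurwitz (size L1) d.1, d.2))
  (fun Y d => (hurwitzV (size L1) d.1, d.2))) => [Z Y f|Z Y f|Y|Y] [U T] /=.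
- by rewrite /dmap /= map_hurwitz.
- by rewrite /dmap /= map_hurwitzV.
- move=> [/= sT sys /split2[U1 [u [v [U2 [UE sU1 [LU1 au bv LU2]]]]]] QT].
  rewrite hurwitzK; split=> //; split=> //=; rewrite UE -sU1 hurwitz_cat.
    by apply: leg_system_hurwitz; rewrite -UE.
  by rewrite all2_cat //= LU1 bv annihilatesJ au.
move=> [/= sT sys /split2[U1 [u [v [U2 [UE sU1 [LU1 au bv LU2]]]]]] QT].
rewrite hurwitzVK; split=> //; split=> //=; rewrite UE -sU1 hurwitzV_cat.
  by apply: leg_system_hurwitzV; rewrite -UE.
by rewrite all2_cat //= LU1 annihilatesJ bv au.
Qed.

(** Neighbour exchanges generate all permutations: the head [a] of [L] is
    moved to its place in [L'], and the rest is handled behind a fixed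
    prefix. *)
Lemma gdaha_relations_perm L L' (X : pzAlgType B) : perm_eq L L' ->
  (exists x : datum X, universal (@gdaha_relations L) x) ->
  exists x : datum X, universal (@gdaha_relations L') x.
Proof.
have bubble L1 L2 a L3 :
    (exists x, @universal B (@gdaha_relations (L1 ++ a :: L2 ++ L3)) X x) ->
    exists x, @universal B (@gdaha_relations (L1 ++ L2 ++ a :: L3)) X x.
  elim: L2 L1 => //= b L2 IH L1 [x /gdaha_relations_swap xu].
  rewrite -cat_rcons; apply: IH; rewrite cat_rcons.
  by eexists; exact: xu.
move=> LL'; suff gen L1 :
    (exists x, @universal B (@gdaha_relations (L1 ++ L)) X x) ->
    exists x, @universal B (@gdaha_relations (L1 ++ L')) X x.
  exact: (gen [::]).
elim: L L' LL' L1 => [|a L IH] L' LL' L1.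
  by move: LL'; rewrite perm_sym => /perm_nilP->.
have aL' : a \in L' by rewrite -(perm_mem LL') mem_head.
case/splitPr: aL' LL' => p1 p2.
rewrite perm_sym -[a :: p2]cat1s perm_catCA perm_cons perm_sym => Lp xL.
by apply: bubble; rewrite -cat_rcons; apply: (IH _ Lp); rewrite cat_rcons.
Qed.

End Systems.

(** * The relations in terms of indexed families *)

Lemma all2_map (A S T : Type) (r : S -> T -> bool) f g (s : seq A) :
  all2 r [seq f i | i <- s] [seq g i | i <- s] = all (fun i => r (f i) (g i)) s.
Proof. by elim: s => //= x s ->. Qed.

Section IndexedFamilies.
Local Open Scope group_scope.
Variables (G : groupType) (S : nat -> G).
Implicit Types (a m : nat) (x : G).

Lemma braid4E x t : braid4 x t = (x * t * x * t == t * x * t * x).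
Proof. by rewrite /braid4 /commb !mulgA. Qed.

Lemma braid_chain_iota a m : reflect
  ((forall i, (a <= i)%N -> (i.+1 < a + m)%N ->
      S i * S i.+1 * S i = S i.+1 * S i * S i.+1)
   /\ (forall i j, (a <= i)%N -> (i.+1 < j)%N -> (j < a + m)%N ->
      S i * S j = S j * S i))
  (braid_chain [seq S i | i <- iota a m]).
Proof.
elim: m a => [|[|m] IH] a; first by constructor; split; lia.
  by constructor; split; lia.
apply: (iffP andP) => [[/andP[/eqP b3 /allP cm]] /IH[B3 CM]|[B3 CM]].
  split=> [i|i j]; rewrite leq_eqVlt => /orP[/eqP<-|ai].
  - by rewrite b3.
  - by move=> im; apply: B3 => //; lia.
  - move=> aj jm; apply/eqP/cm/map_f; rewrite mem_iota; lia.
  by move=> ij jm; apply: CM => //; lia.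
split; last by apply/IH; split=> [i|i j] *; [apply: B3 | apply: CM]; lia.
apply/andP; split; first by apply/eqP/B3; lia.
apply/allP => s /mapP[j]; rewrite mem_iota => jm ->; apply/eqP/CM; lia.
Qed.

Lemma near_iota a m x : reflect
  ((0 < m)%N -> x * S a * x * S a = S a * x * S a * x
   /\ forall j, (a < j < a + m)%N -> x * S j = S j * x)
  (near [seq S i | i <- iota a m] x).
Proof.
case: m => [|m]; first by constructor; lia.
rewrite /= braid4E.
apply: (iffP andP) => [[/eqP-> /allP xT] _|/(_ isT)[-> xT]].
  by split=> // j jm; apply/eqP/xT/map_f; rewrite mem_iota; lia.
split=> //; apply/allP => s /mapP[j]; rewrite mem_iota => jm ->.
by apply/eqP/xT; lia.
Qed.

Lemma near_rev_iota a m x : reflect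
  ((0 < m)%N ->
    let b := (a + m).-1 in
    x * S b * x * S b = S b * x * S b * x
   /\ forall j, (a <= j < b)%N -> x * S j = S j * x)
  (near (rev [seq S i | i <- iota a m]) x).
Proof.
case: m => [|m]; first by constructor; lia.
rewrite -(addn1 m) iotaD map_cat rev_cat /= braid4E addn1 (addnS a m) /=.
apply: (iffP andP) => [[/eqP-> /allP xT] _|/(_ isT)[-> xT]].
  split=> // j jm; apply/eqP/xT; rewrite mem_rev map_f // mem_iota; lia.
split=> //; apply/allP => y; rewrite mem_rev => /mapP[j]; rewrite mem_iota => jm ->.
by apply/eqP/xT; lia.
Qed.

Lemma twist_iota a m x y : reflect
  ((0 < m)%N -> x * (S a)^-1 * y * S a = (S a)^-1 * y * S a * x)
  (twist [seq S i | i <- iota a m] x y).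
Proof.
case: m => [|m]; first by constructor.
rewrite /= /commb conjgE !mulgA.
by apply: (iffP eqP) => [xy _ //|/(_ isT)].
Qed.

Lemma twist_last_iota a m x y : reflect
  ((0 < m)%N -> let b := (a + m).-1 in
     S b * x * (S b)^-1 * y = y * S b * x * (S b)^-1)
  (twist_last [seq S i | i <- iota a m] x y).
Proof.
case: m => [|m]; first by constructor.
rewrite -(addn1 m) iotaD map_cat /=.
have -> : twist_last ([seq S i | i <- iota a m] ++ [:: S (a + m)]) x y =
    commb (x ^ (S (a + m))^-1) y.
  by rewrite /twist_last; case: (map _ _) => //= s t; rewrite last_cat.
rewrite /commb conjgE invgK !mulgA addn1 (addnS a m) /=.
by apply: (iffP eqP) => [xy _ //|/(_ isT)].
Qed.

End IndexedFamilies.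

Lemma pairwise_iota (A : eqType) (f : nat -> A) (r : rel A) a m : reflect
  (forall i j, (a <= i)%N -> (i < j)%N -> (j < a + m)%N -> r (f i) (f j))
  (pairwise r [seq f i | i <- iota a m]).
Proof.
elim: m a => [|m IH] a; first by constructor; lia.
apply: (iffP andP) => [[/allP af /IH rf] i j|rf].
  rewrite leq_eqVlt => /orP[/eqP<-|ai] ij jm.
    by apply/af/map_f; rewrite mem_iota; lia.
  by apply: rf => //; lia.
split; last by apply/IH => i j *; apply: rf; lia.
by rewrite all_map; apply/allP => j; rewrite mem_iota => jm; apply: rf; lia.
Qed.

Section Families.
Variables (P : pred nat) (A : Type) (z : A).

(** The shape of the generators of both algebras: trivial outside of the
    admissible labels. *)
Definition extend (y : {i | P i} -> A) (i : nat) : A := oapp y z (insub i).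

Lemma extend_val y x : extend y (val x) = y x.
Proof. by rewrite /extend valK. Qed.

Lemma extend_restrict (s : nat -> A) i : P i -> extend (s \o val) i = s i.
Proof. by move=> Pi; rewrite /extend insubT. Qed.

End Families.

Lemma umap_extend (X Y : pzRingType) (f : {rmorphism X -> Y}) (P : pred nat)
    (y : {i | P i} -> units X) i :
  umap f (extend 1%g y i) = extend 1%g (umap f \o y) i.
Proof. by rewrite /extend; case: insub => //=; exact: umap1. Qed.

Lemma eval_tprod (R : pzRingType) (G I : Type) (Y : pzRingType) (e : R -> Y)
    (y : G -> units Y) (r : seq I) F : e 1 = 1 ->
  eval e y (tprod r F) = \prod_(i <- r) eval e y (F i).
Proof.
move=> e1; rewrite /tprod; elim: r => [|i r IH]; first by rewrite !big_nil.
by rewrite !big_cons /= IH.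
Qed.

(** * The GDAHA is universal for its relations *)

Section GdahaSystem.
Variables (K : comPzRingType) (d : seq nat) (n : nat).
Hypothesis n_gt0 : (0 < n)%N.
Local Notation B := (gdaha_ring K d).

Definition leg_params : seq (seq B) :=
  [seq [seq u_ K d k j | j <- iota 1 (leg d k)] | k <- iota 1 (size d)].

Definition quad_params : seq B := [:: t_ K d; - tV_ K d].

Section Family.
Variables (Y : pzAlgType B) (y : gdaha_gen d n -> units Y).

Definition famU : nat -> units Y := extend 1%g (y \o inl).
Definition famT : nat -> units Y := extend 1%g (y \o inr).

Definition gdaha_datum : datum Y :=
  ([seq famU k | k <- iota 1 (size d)], [seq famT i | i <- iota 1 n.-1]).

Local Notation ev := (eval (fun b : B => algmap (idfun b)) y).

Lemma eval_U k : ev (U_ K d n k) = uval (famU k).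
Proof. by rewrite /U_ /famU /extend; case: insub => //=; rewrite rmorph1. Qed.

Lemma eval_T i : ev (T_ K d n i) = uval (famT i).
Proof. by rewrite /T_ /famT /extend; case: insub => //=; rewrite rmorph1. Qed.

Lemma eval_TV i : ev (TV_ K d n i) = uval (famT i)^-1%g.
Proof.
by rewrite /TV_ /famT /extend; case: insub => //=; rewrite rmorph1.
Qed.

Lemma gdaha_satisfies :
  satisfies idfun (@gdaha_rel K d n) y <->
  gdaha_relations n quad_params leg_params gdaha_datum.
Proof.
have alg1 : algmap (idfun (1 : B)) = 1 :> Y by rewrite rmorph1.
have legE k :
    ev (tprod (iota 1 (leg d k)) (fun j => U_ K d n k - Cst (u_ K d k j))%T)
    = \prod_(b <- [seq u_ K d k j | j <- iota 1 (leg d k)])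
        (uval (famU k) - algmap b).
  by rewrite eval_tprod // big_map; apply: eq_bigr => j _ /=; rewrite eval_U.
have quadE i : ev ((T_ K d n i - Cst (t_ K d)) * (T_ K d n i + Cst (tV_ K d)))%T
    = \prod_(b <- quad_params) (uval (famT i) - algmap b).
  by rewrite !big_cons big_nil mulr1 /= eval_T rmorphN opprK.
have prodE : ev (tprod (iota 1 (size d)) (U_ K d n)
    * tprod (iota 1 n.-1 ++ rev (iota 1 n.-1)) (T_ K d n))%T
    = uval (\prod_(u <- gdaha_datum.1) u * pure_turn gdaha_datum.2)%g.
  rewrite uvalM /pure_turn uvalM !uval_prod -map_rev !big_map /= !eval_tprod //.
  rewrite big_cat /=; congr (_ * (_ * _)); apply: eq_bigr => i _;
  [exact: eval_U | exact: eval_T | exact: eval_T].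
split=> [sat|[_ /and4P[/braid_chain_iota[b3 cm] /allP nU twU /eqP prod1] aU aT]].
  split=> /=; first by rewrite size_map size_iota.
  - apply/and4P; split.
    + apply/braid_chain_iota; split=> [i i1 im|i j i1 ij jm];
      apply: uval_inj.
        have := sat _ _ (@gdaha_braid3 K d n i _ _).
        by rewrite /= !eval_T; apply; lia.
      have := sat _ _ (@gdaha_commT K d n i j _ _ _).
      by rewrite /= !eval_T; apply; lia.
    + rewrite all_map; apply/allP => k; rewrite mem_iota => kd.
      apply/near_iota => n1; split=> [|j jn]; apply: uval_inj.
        have := sat _ _ (@gdaha_braid4 K d n k _ _).
        rewrite /= !eval_T !eval_U; apply; lia.
      have := sat _ _ (@gdaha_commUT K d n k j _ _).
      rewrite /= !eval_T !eval_U; apply; lia.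
    + apply/pairwise_iota => k l k1 kl ld; apply/twist_iota => n1.
      apply: uval_inj.
      have := sat _ _ (@gdaha_twist K d n k l _ _ _ _).
      rewrite /= !eval_T !eval_U eval_TV; apply; lia.
    apply/eqP/uval_inj; rewrite -prodE (sat _ _ (@gdaha_prod K d n)) /=.
    exact: rmorph1.
  - rewrite /leg_params /gdaha_datum /= all2_map; apply/allP => k.
    rewrite mem_iota => kd; apply/eqP.
    by rewrite -legE (sat _ _ (@gdaha_leg K d n k _)) /= ?rmorph0 //; lia.
  rewrite all_map; apply/allP => i; rewrite mem_iota => im.
  apply/eqP.
  by rewrite -quadE (sat _ _ (@gdaha_quad K d n i _)) /= ?rmorph0 //; lia.
move=> s t [].
- move=> k kd; rewrite legE /= rmorph0; apply/eqP.
  move: aU; rewrite /leg_params /gdaha_datum all2_map => /allP; apply.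
  by rewrite mem_iota; lia.
- move=> i im; rewrite quadE /= rmorph0; apply/eqP.
  by move: aT; rewrite all_map => /allP; apply; rewrite mem_iota; lia.
- by rewrite prodE prod1 /= rmorph1.
- move=> i j im jm ij; rewrite /= !eval_T -!uvalM; congr uval.
  by case/orP: ij => ij; [apply: cm | apply/esym/cm]; lia.
- by move=> i i1 im; rewrite /= !eval_T -!uvalM b3 //; lia.
- move=> k j kd jn; rewrite /= eval_T eval_U -!uvalM; congr uval.
  have : near gdaha_datum.2 (famU k).
    by apply/nU/map_f; rewrite mem_iota; lia.
  by case/near_iota => [|_]; [lia | apply; lia].
- move=> k kd n1; rewrite /= eval_T eval_U -!uvalM; congr uval.
  have : near gdaha_datum.2 (famU k).
    by apply/nU/map_f; rewrite mem_iota; lia.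
  by case/near_iota => //; lia.
move=> k l k1 kl ld n1; rewrite /= eval_T !eval_U eval_TV -!uvalM; congr uval.
have /twist_iota : twist gdaha_datum.2 (famU k) (famU l).
  by move/pairwise_iota: twU; apply => //; lia.
by apply; lia.
Qed.

End Family.

Lemma gdaha_universal : universal (gdaha_relations n quad_params leg_params)
  (gdaha_datum (@punit _ _ (@gdaha_rel K d n) :
     gdaha_gen d n -> units (gdaha K d n))).
Proof.
apply: (presentation_universal (D := gdaha_datum)) (palg_presentation _).
- move=> X Y f x; rewrite /dmap /= -!map_comp; congr pair; apply: eq_map => k;
  exact: umap_extend.
- move=> Y y z [/eq_in_map yzU /eq_in_map yzT] [k|i].
    have := yzU (val k); rewrite /famU !extend_val; apply.
    by rewrite mem_iota; have := valP k; lia.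
  have := yzT (val i); rewrite /famT !extend_val; apply.
  by rewrite mem_iota; have := valP i; lia.
- exact: gdaha_satisfies.
move=> Y [U T] [/= sT _ aU _].
have sU : size U = size d.
  by move: aU; rewrite all2E size_map size_iota => /andP[/eqP].
exists (fun g => match g with
  | inl k => nth 1%g U (val k).-1 | inr i => nth 1%g T (val i).-1 end).
congr pair; apply: (@eq_from_nth _ 1%g); rewrite size_map size_iota ?sU ?sT //.
  move=> k kd; rewrite (nth_map 0%N) ?size_iota // nth_iota //.
  rewrite /famU (extend_restrict _ (fun i => nth 1%g U i.-1)) ?add1n //=; lia.
move=> k kd; rewrite (nth_map 0%N) ?size_iota // nth_iota //.
rewrite /famT (extend_restrict _ (fun i => nth 1%g T i.-1)) ?add1n //=; lia.
Qed.

End GdahaSystem.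

(** * The Hecke algebra is universal for its relations *)

Section HeckeSystem.
Variables (k : comPzRingType) (R : realType) (W : cryst_family R) (n : nat).
Hypothesis n_gt0 : (0 < n)%N.
Variables (B : comPzRingType) (phi : {rmorphism hecke_ring k W n -> B}).
Local Notation N := (ngens W n).
Local Notation s i j := (s_ k W n i j).
Local Notation order i := (refl_order W n i).

(** [S_1] and the reflections attached to the last strand. *)
Definition end_labels : seq nat := 1%N :: iota n.+1 (N - n).

Variables (Q : seq B) (inv0 : nat -> B).
Hypothesis quadQ : (1 < n)%N -> Q = [seq phi (s 2 j) | j <- iota 1 2].
Hypothesis inv0P : {in iota 1 (order 0), forall j, inv0 j * phi (s 0 j) = 1}.

Definition end_params : seq (seq B) :=
  [seq [seq phi (s i j) | j <- iota 1 (order i)] | i <- end_labels].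

Definition inv_params : seq B := [seq inv0 j | j <- iota 1 (order 0)].

Lemma ngens_cases : (N = n.+2 /\ isG2 W) \/ (N = n.+1 /\ isG2 W = false).
Proof. by rewrite /ngens; case: isG2; [left | right]. Qed.

Section Family.
Variables (Y : pzAlgType B) (y : hecke_gen W n -> units Y).

Definition famS : nat -> units Y := extend 1%g y.

Definition hecke_datum : datum Y :=
  ([seq famS i | i <- end_labels], [seq famS i | i <- iota 2 n.-1]).

Local Notation ev := (eval (fun b => algmap (phi b)) y).
Local Notation TT := [seq famS i | i <- iota 2 n.-1].

Lemma eval_S i : ev (S_ k W n i) = uval (famS i).
Proof. by rewrite /S_ /famS /extend; case: insub => //=; rewrite !rmorph1. Qed.

Lemma eval_SV i : ev (SV_ k W n i) = uval (famS i)^-1%g.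
Proof.
by rewrite /SV_ /famS /extend; case: insub => //=; rewrite !rmorph1.
Qed.

(** The labels in the order in which they occur in [S_0]. *)
Lemma iota_gens : iota 1 N = 1%N :: iota 2 n.-1 ++ iota n.+1 (N - n).
Proof.
have -> : N = (1 + n.-1 + (N - n))%N by case: ngens_cases => -[->]; lia.
by rewrite !iotaD /=; congr (_ :: _ ++ _); congr iota; lia.
Qed.

Lemma eval_S0 : ev (S0 k W n) = uval (hecke_word hecke_datum.2 hecke_datum.1).
Proof.
rewrite /S0 eval_tprod ?rmorph1 // /sigma0 iota_gens.
rewrite (eq_bigr (fun i => uval (famS i))) => [|i _]; last exact: eval_S.
rewrite -(big_map famS xpredT (@uval Y)) -uval_prod; congr uval.
rewrite /hecke_word /= take0 big_seq1 map_cat /= map_cat map_rev.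
by rewrite big_cons !big_cat /= !mulgA.
Qed.

Lemma hecke_satisfies :
  satisfies phi (@hecke_rel k R W n) y <->
  hecke_relations n Q end_params inv_params hecke_datum.
Proof.
have alg1 : algmap (phi 1) = 1 :> Y by rewrite !rmorph1.
have orderE i : ev (tprod (iota 1 (order i))
      (fun j => refl_elt k W n i - Cst (s i j))%T) =
    \prod_(b <- [seq phi (s i j) | j <- iota 1 (order i)])
       (ev (refl_elt k W n i) - algmap b).
  by rewrite eval_tprod // big_map.
have annE i : (0 < i)%N ->
    (annihilates [seq phi (s i j) | j <- iota 1 (order i)] (famS i) : Prop) <->
    ev (tprod (iota 1 (order i)) (fun j => refl_elt k W n i - Cst (s i j))%T)
      = ev (Cst 0).
  move=> i0; rewrite orderE /= !rmorph0 /refl_elt eqn0Ngt i0 eval_S.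
  by split=> [/eqP|/eqP].
have ann0 : (annihilates inv_params
      (hecke_word hecke_datum.2 hecke_datum.1)^-1%g : Prop) <->
    ev (tprod (iota 1 (order 0)) (fun j => refl_elt k W n 0 - Cst (s 0 j))%T)
      = ev (Cst 0).
  rewrite orderE /= !rmorph0 eval_S0 (annihilates_inv _ inv0P).
  by split=> [/eqP|/eqP].
have midE i : (2 <= i <= n)%N ->
    [seq phi (s i j) | j <- iota 1 (order i)] = Q.
  move=> i2; rewrite quadQ; last lia.
  have -> : order i = 2%N by rewrite /refl_order i2.
  by apply: eq_map => j; rewrite /s_ i2 (_ : (2 <= 2 <= n)%N) //; lia.
split=> [sat|[_ sys aE a0 aT]].
  split=> /=; first by rewrite size_map size_iota.
  - apply/andP; split.
      apply/braid_chain_iota; split=> [i i2 im|i j i2 ij jm]; apply: uval_inj.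
        have := sat _ _ (@hecke_braid3_rel k R W n i _ _).
        by rewrite /= !eval_S; apply; lia.
      have := sat _ _ (@hecke_comm k R W n i j _ _); rewrite /= !eval_S; apply.
        lia.
      by rewrite /hecke_commuting; case: isG2; lia.
    apply/and4P; split.
    + apply/near_iota => n1; split=> [|j jn]; apply: uval_inj.
        have := sat _ _ (@hecke_braid4_rel k R W n 1 2 _ _).
        rewrite /= !eval_S; apply; first by lia.
        by rewrite /hecke_braid4; case: isG2; rewrite !inE eqxx.
      have := sat _ _ (@hecke_comm k R W n 1 j _ _); rewrite /= !eval_S; apply.
        lia.
      by rewrite /hecke_commuting; case: isG2; lia.
    + rewrite all_map; apply/allP => i; rewrite mem_iota => iN.
      apply/near_rev_iota => n1 b.
      have {b}-> : b = n by rewrite /b; lia.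
      split=> [|j jn]; apply: uval_inj; last first.
        have := sat _ _ (@hecke_comm k R W n i j _ _); rewrite /= !eval_S; apply.
          lia.
        by rewrite /hecke_commuting; case: ngens_cases iN => -[-> ->]; lia.
      case: ngens_cases iN => -[NE WE] iN.
        have := sat _ _ (@hecke_braid4_rel k R W n i n _ _).
        rewrite /= !eval_S; apply; first by lia.
        by rewrite /hecke_braid4 WE !inE !xpair_eqE; lia.
      have {iN}-> : i = n.+1 by lia.
      have := sat _ _ (@hecke_braid4_rel k R W n n n.+1 _ _).
      rewrite /= !eval_S => H; apply/esym/H; first by lia.
      by rewrite /hecke_braid4 WE !inE !xpair_eqE !eqxx orbT.
    + case: (posnP n.-1) => [->//|n1]; apply/orP; right.
      rewrite all_map; apply/allP => i; rewrite mem_iota => iN.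
      apply/eqP/esym/uval_inj.
      have := sat _ _ (@hecke_comm k R W n i 1 _ _); rewrite /= !eval_S; apply.
        lia.
      by rewrite /hecke_commuting; case: ngens_cases iN => -[-> ->]; lia.
    apply/pairwise_iota => i j i1 ij jN; apply/twist_last_iota => n1 b.
    have {b}-> : b = n by rewrite /b; lia.
    case: ngens_cases => -[NE WE]; last lia.
    have [-> ->] : i = n.+1 /\ j = n.+2 by lia.
    apply: uval_inj; have := sat _ _ (@hecke_twist k R W n _ WE).
    by rewrite /= !eval_S eval_SV; apply; lia.
  - change (all2 (@annihilates B Y) end_params hecke_datum.1 : Prop).
    rewrite /end_params /hecke_datum all2_map; apply/allP => i iE.
    have [i0 iN] : (0 < i)%N /\ (i <= N)%N.
      move: iE; rewrite inE mem_iota; case: ngens_cases => -[-> _]; lia.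
    exact/annE/sat/hecke_order.
  - exact/ann0/sat/hecke_order.
  rewrite all_map; apply/allP => i; rewrite mem_iota => im /=.
  have i2 : (2 <= i <= n)%N by lia.
  rewrite -(midE i i2); apply/annE; first by lia.
  by apply/sat/hecke_order; case: ngens_cases => -[-> _]; lia.
move: sys; rewrite /hecke_system /= => /andP[/braid_chain_iota[b3 cm]].
move=> /and4P[/near_iota nx /allP ny /orP xy /pairwise_iota tw].
have comm i j :
    (1 < n)%N -> (0 < i)%N -> (i.+1 < j)%N -> (j <= N)%N -> (i < n)%N ->
    (famS i * famS j = famS j * famS i)%g.
  move=> n1 i0 ij jN ltin; case: (leqP j n) => [jn|nj].
    case: (leqP i 1) => i1; last by apply: cm; lia.
    have i_eq1 : i = 1%N by lia.
    subst i.
    have [|_ xj] := nx; first by lia.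
    by apply: xj; lia.
  have yj : famS j \in [seq famS i | i <- iota n.+1 (N - n)].
    by apply: map_f; rewrite mem_iota; lia.
  case: (leqP i 1) => i1.
    have i_eq1 : i = 1%N by lia.
    subst i.
    case: xy => [|/allP/(_ _ yj)/eqP //]; rewrite /nilp size_map size_iota; lia.
  have /near_rev_iota[] := ny _ yj; first by lia.
  by move=> _ yT; apply/esym/yT; lia.
have braid_far j : (1 < n)%N -> (n < j <= N)%N ->
    (famS j * famS n * famS j * famS n = famS n * famS j * famS n * famS j)%g.
  move=> n1 jN; have yj : famS j \in [seq famS i | i <- iota n.+1 (N - n)].
    by apply: map_f; rewrite mem_iota; lia.
  have /near_rev_iota[] := ny _ yj; first by lia.
  by have -> : (2 + n.-1).-1 = n by lia.
move=> u v [].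
- move=> i j n1; rewrite /= !eval_S -!uvalM => ij; congr uval.
  have : ((0 < i) && (i.+1 < j) && (j <= N) && (i < n))%N
     || ((0 < j) && (j.+1 < i) && (i <= N) && (j < n))%N.
    by move: ij; rewrite /hecke_commuting; case: ngens_cases => -[-> ->]; lia.
  case/orP => /andP[/andP[/andP[i0 lij] jN] ltn]; first exact: comm.
  exact/esym/comm.
- move=> i n1 i2; rewrite /= !eval_S -!uvalM; congr uval; apply: b3; lia.
- move=> i j n1; rewrite /= !eval_S -!uvalM => ij; congr uval.
  have b12 : (famS 1 * famS 2 * famS 1 * famS 2
      = famS 2 * famS 1 * famS 2 * famS 1)%g by case: nx => //; lia.
  move: ij; rewrite /hecke_braid4; case: ngens_cases => -[NE ->]; rewrite !inE.
    by case/or3P=> /eqP[-> ->] //; apply: braid_far; rewrite ?NE; lia.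
  by case/orP=> /eqP[-> ->] //; apply/esym/braid_far; rewrite ?NE; lia.
- move=> n1 WE; rewrite /= !eval_S eval_SV -!uvalM; congr uval.
  case: ngens_cases => -[NE]; last by rewrite WE.
  move=> _; have /twist_last_iota : twist_last TT (famS n.+1) (famS n.+2).
    by apply: tw; lia.
  have -> : (2 + n.-1).-1 = n by lia.
  by apply; lia.
move=> i iN; case: (posnP i) => [->|i0]; first exact/ann0.
apply/annE => //; case: (boolP (2 <= i <= n)%N) => i2.
  rewrite midE //; move: aT; rewrite all_map => /allP; apply.
  by rewrite mem_iota; lia.
move: aE; rewrite /end_params /hecke_datum all2_map => /allP; apply.
rewrite inE mem_iota; lia.
Qed.

End Family.

Lemma hecke_universal : universal (hecke_relations n Q end_params inv_params)
  (hecke_datum (umap (@tincl _ _ phi (hecke k W n)) \o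
     @punit _ _ (@hecke_rel k R W n) :
     hecke_gen W n -> units (base_change phi (hecke k W n)))).
Proof.
apply: (presentation_universal (D := hecke_datum))
  (base_change_presentation _ _).
- move=> X Y f x; rewrite /dmap /= -!map_comp umap_extend.
  by congr ((_ :: _), _); apply: eq_map => i; exact: umap_extend.
- move=> Y y z [y1 /eq_in_map yzU /eq_in_map yzT] i.
  rewrite -(extend_val 1%g y) -[RHS](extend_val 1%g z).
  have := valP i; move: (val i) => {}i; rewrite -/(ngens W n) => iN.
  case: (leqP i 1) => i1; first by have -> : i = 1%N by lia.
  case: (leqP i n) => iln; first by apply: yzT; rewrite mem_iota; lia.
  by apply: yzU; rewrite mem_iota; case: ngens_cases iN => -[-> _]; lia.
- exact: hecke_satisfies.
move=> Y [U T] [sT _ aU _ _]; rewrite /= in sT.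
have : size U = (N - n).+1.
  by move: aU; rewrite all2E => /andP[/eqP <- _]; rewrite size_map /= size_iota.
case: U {aU} => // u U [sU].
have sys : (size (u :: T ++ U) = N)%N.
  by rewrite /= size_cat sU sT; case: ngens_cases => -[-> _]; lia.
exists (fun g => nth 1%g (u :: T ++ U) (val g).-1).
have ext i : (1 <= i <= N)%N -> extend 1%g (fun g : hecke_gen W n =>
    nth 1%g (u :: T ++ U) (val g).-1) i = nth 1%g (u :: T ++ U) i.-1.
  exact: (extend_restrict _ (fun i => nth 1%g (u :: T ++ U) i.-1)).
rewrite /hecke_datum /famS /= ext /=; last by case: ngens_cases => -[-> _]; lia.
congr ((_ :: _), _); apply: (@eq_from_nth _ 1%g);
  rewrite size_map size_iota ?sU ?sT // => i ilt;
  rewrite (nth_map 0%N) ?size_iota // nth_iota // ext /=;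
  try by case: ngens_cases ilt => -[-> _]; lia.
  rewrite (_ : (n + i = (n.-1 + i).+1)%N) /=; last lia.
  by rewrite nth_cat sT ltnNge leq_addr /= addKn.
by rewrite nth_cat sT add0n ilt.
Qed.

End HeckeSystem.

(** * Matching the parameters *)

Lemma perm_map_lift (A C : eqType) (f : A -> C) (s : seq A) (t : seq C) :
  perm_eq t (map f s) -> exists2 s', perm_eq s' s & map f s' = t.
Proof.
elim: t s => [|c t IH] s tfs.
  by exists [::] => //; case: s tfs => // a s /perm_size.
have /mapP[a sa ca] : c \in map f s by rewrite -(perm_mem tfs) mem_head.
have s_rem := perm_to_rem sa.
have /IH[s' s'E <-] : perm_eq t (map f (rem a s)).
  by rewrite -(perm_cons c) (perm_trans tfs) // ca -map_cons perm_map.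
exists (a :: s'); last by rewrite /= -ca.
by rewrite perm_sym (perm_trans s_rem) // perm_cons perm_sym.
Qed.

Section Matching.
Variables (k : comPzRingType) (K : comPzRingType) (iota : {rmorphism k -> K}).
Variables (R : realType) (W : cryst_family R) (n : nat) (d labels : seq nat).
Hypothesis n_gt0 : (0 < n)%N.
Hypothesis labelsP : perm_eq labels (rcons (end_labels W n) 0%N).
Hypothesis d_labels : map (refl_order W n) labels = d.
Local Notation N := (ngens W n).
Local Notation order i := (refl_order W n i).
Local Notation B := (gdaha_ring K d).

Lemma mem_labels i : (i \in labels) = (i <= N)%N && ~~ (2 <= i <= n)%N.
Proof.
rewrite (perm_mem labelsP) mem_rcons !inE mem_iota.
by case: (ngens_cases W n) => -[-> _]; lia.
Qed.

Lemma labels_uniq : uniq labels.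
Proof.
rewrite (perm_uniq labelsP) rcons_uniq /= iota_uniq !inE !mem_iota /=; lia.
Qed.

Lemma leg_label i : i \in labels -> leg d (index i labels).+1 = order i.
Proof.
move=> iL; rewrite /leg /= -d_labels (nth_map 0%N) ?index_mem //.
by rewrite nth_index.
Qed.

Lemma leg_of_label_subproof (x : special_param W n) :
  let kj := ((index (val x).1 labels).+1, (val x).2) in
  (1 <= kj.1 <= size d)%N && (1 <= kj.2 <= leg d kj.1)%N.
Proof.
case: x => [[i j]] /= /and3P[iN i2 ij].
have iL : i \in labels by rewrite mem_labels iN.
by rewrite leg_label // ij -d_labels size_map index_mem iL.
Qed.

(** The reflection with label [i] gets the leg at the position of [i] in
    [labels], a list that is arranged so that orders and leg lengths agree. *)
Definition leg_of_label (x : special_param W n) : leg_param d :=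
  exist (fun kj : nat * nat =>
      is_true ((1 <= kj.1 <= size d)%N && (1 <= kj.2 <= leg d kj.1)%N))
    ((index (val x).1 labels).+1, (val x).2) (leg_of_label_subproof x).

Lemma label_of_leg_subproof (x : leg_param d) :
  let ij := (nth 0%N labels (val x).1.-1, (val x).2) in
  [&& (ij.1 <= N)%N, ~~ (2 <= ij.1 <= n)%N & (1 <= ij.2 <= order ij.1)%N].
Proof.
case: x => [[l j]] /= /andP[/andP[l1 ld] lj].
have ls : (l.-1 < size labels)%N by move: ld; rewrite -d_labels size_map; lia.
have := mem_nth 0%N ls; rewrite mem_labels => /andP[-> ->] /=.
by move: lj; rewrite /leg -d_labels (nth_map 0%N).
Qed.

Definition label_of_leg (x : leg_param d) : special_param W n :=
  exist (fun ij : nat * nat => is_true [&& (ij.1 <= N)%N, ~~ (2 <= ij.1 <= n)%N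
      & (1 <= ij.2 <= order ij.1)%N])
    (nth 0%N labels (val x).1.-1, (val x).2) (label_of_leg_subproof x).

Lemma leg_of_label_bij : bijective leg_of_label.
Proof.
exists label_of_leg => x; apply: val_inj; case: x => [[i j] /= ij] /=.
  have iL : i \in labels by case/and3P: ij => iN i2 _; rewrite mem_labels iN.
  by rewrite nth_index.
have [/andP[i1 id] _] := andP ij; congr pair.
rewrite index_uniq ?labels_uniq ?prednK //.
by move: id; rewrite -d_labels size_map.
Qed.

Definition leg_unit (x : leg_param d) : units B :=
  punit (@laurent_rel K (gdaha_param d)) (inl x).

Lemma tN_subproof : (- tV_ K d * - t_ K d = 1) * (- t_ K d * - tV_ K d = 1).
Proof. by rewrite !mulrNN /t_ /tV_ /lX /lXV pgenVr pgenVl. Qed.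

(** The parameters of [S_0] are inverted because the last loop is conjugate to
    [S_0^-1]; the pair of the quadratic relation goes to [t] and [-t^-1]. *)
Definition param_unit (x : hecke_param W n) : units B :=
  match x with
  | inl x => if (val x).1 == 0%N then (leg_unit (leg_of_label x))^-1%g
             else leg_unit (leg_of_label x)
  | inr x => if val x == 1%N
             then punit (@laurent_rel K (gdaha_param d)) (inr tt)
             else mk_units tN_subproof.1 tN_subproof.2
  end.

(** The letters of a Laurent ring may be sent to arbitrary units of a
    commutative ring. *)
Lemma param_morphism : exists phi : {rmorphism hecke_ring k W n -> B},
  (forall c : k, phi (algmap c) = algmap (iota c)) /\
  forall x, phi (lX k x) = uval (param_unit x).
Proof.
have ec a (z : B) : (algmap \o iota) a * z = z * (algmap \o iota) a :> B.
  exact: mulrC.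
have yrel s t : laurent_rel s t ->
    eval (algmap \o iota : k -> B) param_unit s
    = eval (algmap \o iota) param_unit t.
  by case=> i j /=; exact: mulrC.
have [phi [phic phig]] := palg_lift ec yrel.
exists phi; split=> // x; rewrite -phig; by [].
Qed.

Section Morphism.
Variable phi : {rmorphism hecke_ring k W n -> B}.
Hypothesis phiX : forall x, phi (lX k x) = uval (param_unit x).

Lemma phi_special i j : i \in labels -> j \in seq.iota 1 (order i) ->
  exists2 x : special_param W n, s_ k W n i j = lX k (inl x) /\ (val x).1 = i &
    u_ K d (index i labels).+1 j = uval (leg_unit (leg_of_label x)).
Proof.
move=> iL; rewrite mem_iota => ij.
have [iN i2] := andP (etrans (esym (mem_labels i)) iL).
have xP : [&& (i <= N)%N, ~~ (2 <= i <= n)%N & (1 <= j <= order i)%N].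
  by rewrite iN i2; lia.
exists (exist _ (i, j) xP); first by rewrite /s_ (negPf i2) insubT.
have kjP := leg_of_label_subproof (exist _ (i, j) xP).
rewrite /u_ (insubT (fun kj : nat * nat =>
  (1 <= kj.1 <= size d)%N && (1 <= kj.2 <= leg d kj.1)%N) kjP) /=.
by congr (lX K (inl _)); exact: val_inj.
Qed.

Lemma phi_neq0 i j : i \in labels -> i != 0%N -> j \in seq.iota 1 (order i) ->
  phi (s_ k W n i j) = u_ K d (index i labels).+1 j.
Proof.
move=> iL i0 /(phi_special iL)[x [-> xi] ->].
by rewrite phiX /= xi (negPf i0).
Qed.

Lemma phi_0 : {in seq.iota 1 (order 0),
  forall j, u_ K d (index 0%N labels).+1 j * phi (s_ k W n 0 j) = 1}.
Proof.
move=> j j0; have zL : 0%N \in labels by rewrite mem_labels.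
have [x [-> x0] ->] := phi_special zL j0.
by rewrite phiX /= x0 /= uvalVE uvalV.
Qed.

Lemma phi_shared : (1 < n)%N ->
  phi (s_ k W n 2 1) = t_ K d /\ phi (s_ k W n 2 2) = - tV_ K d.
Proof.
move=> n1; have shared j : (1 <= j <= 2)%N -> (1 < n)%N && (1 <= j <= 2)%N.
  by rewrite n1.
have n2 : (2 <= 2 <= n)%N by lia.
pose P j := (1 < n)%N && (1 <= j <= 2)%N.
by split; rewrite /s_ n2; [rewrite (insubT P (shared 1%N isT))
  | rewrite (insubT P (shared 2%N isT))]; rewrite [LHS]phiX.
Qed.

Lemma phi_legs : perm_eq
  (rcons (end_params phi)
     [seq u_ K d (index 0%N labels).+1 j | j <- seq.iota 1 (order 0)])
  (leg_params K d).
Proof.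
set F := fun i =>
  [seq u_ K d (index i labels).+1 j | j <- seq.iota 1 (order i)].
have -> : end_params phi = map F (end_labels W n).
  apply/eq_in_map => i iE; apply/eq_in_map => j ij.
  have iL : i \in labels by rewrite (perm_mem labelsP) mem_rcons inE iE orbT.
  apply: phi_neq0 => //; move: iE; rewrite inE mem_iota; lia.
rewrite -[X in rcons _ X]/(F 0%N) -map_rcons.
have -> : leg_params K d = map F labels.
  apply: (@eq_from_nth _ [::]).
    by rewrite !size_map size_iota -d_labels size_map.
  move=> i; rewrite size_map size_iota => id.
  have iL : (i < size labels)%N by move: id; rewrite -d_labels size_map.
  rewrite !(nth_map 0%N) ?size_iota // nth_iota // add1n /F.
  rewrite index_uniq ?labels_uniq //; congr map; congr seq.iota.
  by rewrite -leg_label ?mem_nth // index_uniq ?labels_uniq.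
by rewrite perm_map // perm_sym.
Qed.

End Morphism.

End Matching.

Lemma end_orders (R : realType) (W : cryst_family R) n : (0 < n)%N ->
  perm_eq (map (refl_order W n) (rcons (end_labels W n) 0%N))
    (leg_lengths (diagram_of W)).
Proof.
case: n => // n _.
have end1 : (2 <= n.+2 <= n.+1)%N = false by lia.
have end2 : (2 <= n.+3 <= n.+1)%N = false by lia.
have [two one] : (n.+3 - n.+1 = 2)%N /\ (n.+2 - n.+1 = 1)%N by lia.
rewrite /end_labels /ngens.
case: W => [alpha alphaP|||];
by rewrite /isG2 ?two ?one /= /refl_order ?end1 ?end2 ?eqxx.
Qed.

Theorem theorem1p11 (R : realType) (k : comNzRingType)
    (iota : {rmorphism k -> R[i]}) (n : nat) (n_ge1 : (1 <= n)%N)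
    (W : cryst_family R) (d : seq nat)
    (legs_d : perm_eq d (leg_lengths (diagram_of W))) :
  exists phi : {rmorphism hecke_ring k W n -> gdaha_ring R[i] d},
    [/\ forall c : k, phi (algmap c) = algmap (iota c),
        (2 <= n)%N -> phi (s_ k W n 2 1) = t_ R[i] d
                   /\ phi (s_ k W n 2 2) = - tV_ R[i] d,
        exists sigma : special_param W n -> leg_param d,
          bijective sigma /\
          forall x : special_param W n,
            phi (lX k (inl x)) = lX R[i] (inl (sigma x))
            \/ phi (lX k (inl x)) = lXV R[i] (inl (sigma x))
      & alg_isomorphic (base_change phi (hecke k W n)) (gdaha R[i] d n)].
Proof.
have [labels labelsP d_labels] : exists2 labels,
    perm_eq labels (rcons (end_labels W n) 0%N)
    & map (refl_order W n) labels = d.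
  by apply: perm_map_lift; rewrite (perm_trans legs_d) // perm_sym end_orders.
have [phi [phic phiX]] := param_morphism iota n_ge1 labelsP d_labels.
exists phi; split=> //.
- exact: phi_shared phiX.
- exists (leg_of_label n_ge1 labelsP d_labels).
  split; first exact: leg_of_label_bij.
  by move=> x; rewrite phiX /=; case: eqP => _; [right | left].
have quadQ : (1 < n)%N ->
    quad_params R[i] d = [seq phi (s_ k W n 2 j) | j <- seq.iota 1 2].
  by case/(phi_shared phiX) => /= -> ->.
have hecke_u :=
  hecke_gdaha_universal (hecke_universal n_ge1 quadQ (phi_0 phiX)).
have [x xu] := gdaha_relations_perm (phi_legs phiX) (ex_intro _ _ hecke_u).
exact: universal_iso xu (gdaha_universal _ _ n_ge1).
Qed.
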